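(* Let $(N_t)_{t\in\mathbb{R}_+}$ be a standard Poisson process with intensity $\lambda>0$ and jump times $(T_k)_{k\ge1}$. Let $$Y_t=\sum_{k=1}^{N_t}f_k(T_k)(1-Z_k)\prod_{l=k+1}^{N_t}Z_l,\qquad t\in\mathbb{R}_+ ,$$ where $(Z_k)_{k\ge1}$ is an i.i.d. uniform sequence on $[0,1]$, independent of $(N_t)_{t\in\mathbb{R}_+}$. For any $n\ge1$ and $t\in\mathbb{R}_+$, we have $$\mathbb{E}[(Y_t)^n]=\mathrm{e}^{-n\lambda t/(n+1)}\sum_{k=1}^n\lambda^k\sum_{q_0=0<q_1<\cdots<q_k=n}\int_0^t\int_0^{s_k}\cdots\int_0^{s_2}\prod_{l=1}^k\frac{f_l^{q_l-q_{l-1}}(s_l)\,\mathrm{e}^{\lambda s_l\left(\frac{1}{1+q_{l-1}}-\frac{1}{1+q_l}\right)}}{1+q_l}\,ds_1\cdots ds_k .$$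
   Context: $(f_k)_{k\ge1}$ is a family of real-valued functions on $\mathbb{R}_+$, and $f_l^{j}(s)=(f_l(s))^j$. The inner sum runs over all integers $q_1,\ldots,q_{k-1}$ with $0=q_0<q_1<\cdots<q_{k-1}<q_k=n$. Empty products equal $1$ and empty sums equal $0$.
   Formalization: The functions f_k are assumed not to depend on k (f_k = f_1 on R_+): for n = 1, f_1 = 0, f_2 = 1, other f_k = 0 and t > 0 the left side is positive and the right side is 0. Also f_k is taken measurable with f_k^n integrable on [0,t]. *)

(* Defs.v *)
From HB Require Import structures.
From mathcomp Require Import all_boot all_order all_algebra finmap.
From mathcomp Require Import all_classical all_reals all_analysis.

Set Implicit Arguments.
Unset Strict Implicit.
Unset Printing Implicit Defensive.

Import Order.TTheory GRing.Theory Num.Theory.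
Import numFieldNormedType.Exports.

Local Open Scope classical_set_scope.
Local Open Scope ring_scope.

Definition mutually_independent d (Om : measurableType d) (R : realType)
    (P : probability Om R) (I : choiceType) d' (E : measurableType d')
    (X : I -> Om -> E) : Prop :=
  forall (J : {fset I}) (A : I -> set E),
    (forall i, i \in J -> measurable (A i)) ->
    P (\bigcap_(i in [set` J]) (X i @^-1` A i)) =
    (\prod_(i <- J) P (X i @^-1` A i))%E.

(* sigma (X_i : i in D) *)
Definition sigma_of_family d (Om : measurableType d) (I : Type) (D : set I)
    d' (E : measurableType d') (X : I -> Om -> E) : set (set Om) :=
  <<s \bigcup_(i in D) preimage_set_system setT (X i) measurable >>.

Definition independent_sigma d (Om : measurableType d) (R : realType)
    (P : probability Om R) (F G : set (set Om)) : Prop :=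
  forall A B, F A -> G B -> P (A `&` B) = (P A * P B)%E.

(* The clause on [counts] says N_t = #{k >= 1 : T_k <= t}; with the T_k
   increasing it forces N_0 = 0, right-continuous paths with unit jumps exactly
   at T_1 < T_2 < ..., and T_k -> +oo since N_t is finite. The increments are
   taken in nat: truncation is harmless, as the paths are nondecreasing a.s.
   Only N t with t >= 0 and T k with k >= 1 matter. *)
Record poisson_process d (Om : measurableType d) (R : realType)
    (P : probability Om R) (lambda : R)
    (N : R -> {RV P >-> nat}) (T : nat -> {RV P >-> R}) : Prop := {
  jump_times_increasing : {ae P, forall w,
    0 < T 1%N w /\ forall k, (1 <= k)%N -> T k w < T k.+1 w} ;
  counts : {ae P, forall w, forall (t : R) (k : nat), 0 <= t -> (1 <= k)%N ->
    (k <= N t w)%N = (T k w <= t)} ;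
  independent_increments : forall u : nat -> R,
    0 <= u 0%N -> (forall i, u i <= u i.+1) ->
    mutually_independent P (fun (i : nat) w => (N (u i.+1) w - N (u i) w)%N) ;
  poisson_increments : forall (s t : R) (k : nat), 0 <= s -> s < t ->
    P [set w | (N t w - N s w)%N = k] =
    (poisson_pmf (lambda * (t - s)) k)%:E }.

(* (Z_k)_{k >= 1}; Z 0 is ignored. *)
Definition iid_uniform01 d (Om : measurableType d) (R : realType)
    (P : probability Om R) (Z : nat -> {RV P >-> R}) : Prop :=
  mutually_independent P (fun k => Z k.+1 : Om -> R) /\
  forall (k : nat) (A : set R), (1 <= k)%N -> measurable A ->
    distribution P (Z k) A = uniform_prob (@ltr01 R) A.

Definition growth_collapse d (Om : measurableType d) (R : realType)
    (P : probability Om R) (N : R -> {RV P >-> nat})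
    (T Z : nat -> {RV P >-> R}) (f : nat -> R -> R) (t : R) (w : Om) : R :=
  \sum_(1 <= k < (N t w).+1)
    f k (T k w) * (1 - Z k w) * \prod_(k.+1 <= l < (N t w).+1) Z l w.

(* \int_0^t \int_0^{s_k} ... \int_0^{s_2} F [:: s_1; ...; s_k] ds_1 ... ds_k *)
Fixpoint simplex_integral (R : realType) (k : nat) (t : R) (F : seq R -> R)
    : R :=
  if k is k'.+1 then
    \int[@lebesgue_measure R]_(s in `[0, t])
      simplex_integral k' s (fun v => F (rcons v s))
  else F [::].

(* p = [:: q_1; ...; q_k] with 0 = q_0 < q_1 < ... < q_k = n *)
Definition chain_to (n : nat) (p : seq nat) : bool :=
  path ltn 0%N p && (last 0%N p == n).

(* Here q = [:: q_0; q_1; ...; q_k] and s = [:: s_1; ...; s_k]. *)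
Definition chain_integrand (R : realType) (lambda : R) (f : nat -> R -> R)
    (k : nat) (q : seq nat) (s : seq R) : R :=
  let q_ := nth 0%N q in
  \prod_(1 <= l < k.+1)
    (f l s`_l.-1 ^+ (q_ l - q_ l.-1) *
     expR (lambda * s`_l.-1 * ((1 + q_ l.-1)%:R^-1 - (1 + q_ l)%:R^-1)) /
     (1 + q_ l)%:R).

(* Main.v *)
Require Import Defs.
From HB Require Import structures.
From mathcomp Require Import all_boot all_order all_algebra finmap.
From mathcomp Require Import all_classical all_reals all_analysis.
From mathcomp Require Import measurable_realfun.
From mathcomp Require Import zify ring lra.

Set Implicit Arguments.
Unset Strict Implicit.
Unset Printing Implicit Defensive.

Import Order.TTheory GRing.Theory Num.Theory.
Import numFieldNormedType.Exports.

Local Open Scope classical_set_scope.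
Local Open Scope ring_scope.

(* Let X_m be the value just after the m-th jump: X_(m+1) is
   Z_(m+1) X_m + (1 - Z_(m+1)) f(T_(m+1)). Expanding the (m+1)-st value to the
   power n by the binomial formula and integrating out Z_(m+1), the Beta
   integral makes every coefficient equal to 1/(n+1). Hence
   e^(lambda t) E[X_m^n 1_(N_t = m)] is lambda^m J_(m,n)(t), where J_(m+1,n)(t)
   is 1/(n+1) times the sum over j <= n of the integrals over [0, t] of
   f^(n-j) J_(m,j).
   Only independence of increments is needed for this: the identity is proved
   jointly with an arbitrary event of the future of time t, and the density of
   the new jump time is found by summing over a fine partition of [0, t], two
   jumps in one cell being quadratically unlikely.
   Summing over m, S_n = e^(lambda t) E[Y_t^n] solves a linear integral
   equation whose term j = n is removed by the factor e^(-lambda t/(n+1));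
   unfolding the remaining terms j < n yields the sum over chains.
   This is done for bounded f; the general case follows by truncation. *)

(** * Bounded measurable functions *)

(** The jump times are known only through the counts, so their density has to be derived. A jump in
    a cell ]r, s] and no jump in ]s, t] form an event of the future of r; this is why the identity
    for m jumps must accept such events before m + 1 jumps can be treated. The functions are merely
    measurable, hence nothing is differentiated: two expressions are shown equal by bounding the
    increments of their difference by C (s - r)^2.

    The exponents come from integrating factors. With S_j = e^(lambda s/(j+1)) C_j, the factor
    e^(-lambda s/(n+1)) that removes the term j = n leaves e^(lambda s (1/(1+j) - 1/(1+n))) in front
    of C_j, and e^(-lambda t) e^(lambda t/(n+1)) is the prefactor e^(-n lambda t/(n+1)). In the term
    j = n the whole power is carried over by the jump; once it is removed, only strict increases
    remain in the chains.

    Boundedness gives the dominating constants for the series over m. To remove it, |f| is treated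
    by monotone convergence, since the integrability of Y_t^n is part of what has to be shown. *)

Definition bounded_measurable d (T : measurableType d) (R : realType)
    (D : set T) (f : T -> R) : Prop :=
  measurable_fun D f /\ exists K : R, forall x, D x -> `|f x| <= K.

Section bounded_measurable.
Context d (T : measurableType d) (R : realType) (D : set T).
Implicit Types f g : T -> R.

Lemma bounded_measurable_eq f g : (forall x, D x -> f x = g x) ->
  bounded_measurable D f -> bounded_measurable D g.
Proof.
move=> fg [mf [K fK]]; split.
  by apply: eq_measurable_fun mf => x; rewrite inE => /fg.
by exists K => x Dx; rewrite -fg// fK.
Qed.

Lemma bounded_measurable_cst (c : R) : bounded_measurable D (fun=> c).
Proof. by split=> //; exists `|c|. Qed.

Lemma bounded_measurableD f g : bounded_measurable D f ->
  bounded_measurable D g -> bounded_measurable D (fun x => f x + g x).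
Proof.
move=> [mf [K fK]] [mg [L gL]]; split; first exact: measurable_funD.
by exists (K + L) => x Dx; rewrite (le_trans (ler_normD _ _))// lerD ?fK ?gL.
Qed.

Lemma bounded_measurableM f g : bounded_measurable D f ->
  bounded_measurable D g -> bounded_measurable D (fun x => f x * g x).
Proof.
move=> [mf [K fK]] [mg [L gL]]; split; first exact: measurable_funM.
by exists (K * L) => x Dx; rewrite normrM ler_pM ?fK ?gL.
Qed.

Lemma bounded_measurableX f n : bounded_measurable D f ->
  bounded_measurable D (fun x => f x ^+ n).
Proof.
move=> mf; elim: n => [|n ih].
  apply: (bounded_measurable_eq (f := fun=> 1));
    last exact: bounded_measurable_cst.
  by move=> x _; rewrite expr0.
apply: (bounded_measurable_eq (f := fun x => f x * f x ^+ n)).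
  by move=> x _; rewrite exprS.
exact: bounded_measurableM.
Qed.

Lemma bounded_measurable_sum (I : Type) (s : seq I) (p : pred I)
    (F : I -> T -> R) : (forall i, p i -> bounded_measurable D (F i)) ->
  bounded_measurable D (fun x => \sum_(i <- s | p i) F i x).
Proof.
move=> mF; elim: s => [|a s ih].
  apply: (bounded_measurable_eq (f := fun=> 0));
    last exact: bounded_measurable_cst.
  by move=> x _; rewrite big_nil.
apply: (bounded_measurable_eq
  (f := fun x => if p a then F a x + \sum_(i <- s | p i) F i x
                 else \sum_(i <- s | p i) F i x)).
  by move=> x _; rewrite big_cons; case: (p a).
by case: (boolP (p a)) => // pa; apply: bounded_measurableD => //; exact: mF.
Qed.

Lemma bounded_measurable_bool (f : T -> bool) : measurable_fun D f ->
  bounded_measurable D (fun x => (f x)%:R : R).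
Proof.
move=> mf; split; last first.
  by exists 1 => x _; case: (f x); rewrite ?normr1 ?normr0.
by apply: (measurableT_comp (f := fun b : bool => b%:R : R)) => //.
Qed.

Lemma bounded_measurable_indic (A : set T) : measurable A ->
  bounded_measurable D (\1_A : T -> R).
Proof.
move=> mA; split; first exact: measurable_indic.
by exists 1 => x _; rewrite indicE; case: (_ \in _); rewrite ?normr1 ?normr0.
Qed.

Lemma bounded_measurableS (E : set T) f : measurable D -> E `<=` D ->
  bounded_measurable D f -> bounded_measurable E f.
Proof.
move=> mD ED [mf [K fK]]; split; first exact: measurable_funS mf.
by exists K => x /ED; exact: fK.
Qed.

Context (mu : {measure set T -> \bar R}) (mD : measurable D).

Lemma integrable_bounded_mulr f g : mu.-integrable D (EFin \o f) ->
  bounded_measurable D g -> mu.-integrable D (EFin \o (fun x => f x * g x)).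
Proof.
move=> If [mg [K gK]].
apply: (@integrableMl _ _ _ mu _ mD (EFin \o f) g) => //.
exists K; split; first exact: num_real.
by move=> M KM x Dx; apply: le_trans (gK _ Dx) (ltW KM).
Qed.

Lemma integrable_bounded_mull f g : mu.-integrable D (EFin \o f) ->
  bounded_measurable D g -> mu.-integrable D (EFin \o (fun x => g x * f x)).
Proof.
move=> If Bg; have := integrable_bounded_mulr If Bg.
by apply: eq_integrable => // x _; rewrite /= mulrC.
Qed.

Lemma integrable_realD f g : mu.-integrable D (EFin \o f) ->
  mu.-integrable D (EFin \o g) -> mu.-integrable D (EFin \o (fun x => f x + g
    x)).
Proof. by move=> If Ig; have := integrableD mD If Ig. Qed.

Lemma integrable_realB f g : mu.-integrable D (EFin \o f) ->
  mu.-integrable D (EFin \o g) -> mu.-integrable D (EFin \o (fun x => f x - g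
    x)).
Proof. by move=> If Ig; have := integrableB mD If Ig. Qed.

Lemma bounded_measurable_integrable f : (mu D < +oo)%E ->
  bounded_measurable D f -> mu.-integrable D (EFin \o f).
Proof.
move=> Dfin [mf [K fK]]; apply: measurable_bounded_integrable => //.
exists K; split; first exact: num_real.
by move=> M KM x Dx; apply: le_trans (fK _ Dx) (ltW KM).
Qed.

Lemma integrable_sum_real (I : Type) (s : seq I) (p : pred I)
    (F : I -> T -> R) : (forall i, p i -> mu.-integrable D (EFin \o F i)) ->
  mu.-integrable D (EFin \o (fun x => \sum_(i <- s | p i) F i x)).
Proof.
move=> IF; have := integrable_sum mD s IF.
by apply: eq_integrable => // x _; rewrite /= sumEFin.
Qed.

Lemma Rintegral_sum (I : Type) (s : seq I) (p : pred I) (F : I -> T -> R) :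
  (forall i, p i -> mu.-integrable D (EFin \o F i)) ->
  \int[mu]_(x in D) (\sum_(i <- s | p i) F i x) =
  \sum_(i <- s | p i) \int[mu]_(x in D) F i x.
Proof.
move=> IF; elim: s => [|a s ih].
  by under eq_Rintegral do rewrite big_nil;
    rewrite big_nil Rintegral_cst// mul0r.
rewrite big_cons -ih; under eq_Rintegral do rewrite big_cons.
case: ifP => // pa; rewrite RintegralD//; first exact: IF.
exact: integrable_sum_real.
Qed.

Lemma ae_eq_Rintegral f g : measurable_fun D f -> measurable_fun D g ->
  {ae mu, forall x, D x -> f x = g x} ->
  \int[mu]_(x in D) f x = \int[mu]_(x in D) g x.
Proof.
move=> mf mg fg; congr fine.
apply: ae_eq_integral => //; try exact/measurable_EFinP.
by apply: filterS fg => x fg Dx; rewrite fg.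
Qed.

Lemma ae_le_Rintegral f g : mu.-integrable D (EFin \o f) ->
  mu.-integrable D (EFin \o g) -> {ae mu, forall x, D x -> f x <= g x} ->
  \int[mu]_(x in D) f x <= \int[mu]_(x in D) g x.
Proof.
move=> If Ig fg; have mf := measurable_int _ If; have mg := measurable_int _ Ig.
(* This maximum equals [g] almost everywhere and dominates [f] at every point, so the pointwise
   comparison of integrals applies to it. *)
pose h x := Num.max (f x) (g x).
have hE : \int[mu]_(x in D) g x = \int[mu]_(x in D) h x.
  apply: ae_eq_Rintegral; first exact/measurable_EFinP.
    by apply: measurable_maxr; exact/measurable_EFinP.
  by apply: filterS fg => x fg Dx; rewrite /h max_r// fg.
have Ih : mu.-integrable D (EFin \o h).
  have := integrable_realD (integrable_norm If) (integrable_norm Ig).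
  apply: le_integrable => //.
    apply/measurable_EFinP; apply: measurable_maxr; exact/measurable_EFinP.
  move=> x _ /=; rewrite lee_fin [leRHS]ger0_norm ?addr_ge0// /h maxEle.
  by case: ifP => _; rewrite ?lerDl ?lerDr.
rewrite hE; apply: le_Rintegral => // x _; by rewrite /h le_max lexx.
Qed.

Lemma dominated_convergence_Rintegral (f_ : nat -> T -> R) f g :
  (forall n, measurable_fun D (f_ n)) ->
  (forall x, D x -> f_ ^~ x @ \oo --> f x) ->
  mu.-integrable D (EFin \o g) ->
  (forall n x, D x -> `|f_ n x| <= g x) ->
  mu.-integrable D (EFin \o f) /\
  \int[mu]_(x in D) f_ n x @[n --> \oo] --> \int[mu]_(x in D) f x.
Proof.
move=> mf_ f_f Ig f_g.
have mf : measurable_fun D f by exact: measurable_fun_cvg f_f.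
have f_fE x : D x -> (f_ n x)%:E @[n --> \oo] --> (f x)%:E.
  by move=> Dx; apply/fine_cvgP; split; [exact: nearW|exact: f_f].
have [If _ cf] := @dominated_convergence _ _ _ mu D mD (fun n => EFin \o f_ n)
  (EFin \o f) (EFin \o g) (fun n => (measurable_EFinP _ _).2 (mf_ n))
  ((measurable_EFinP _ _).2 mf)
  (aeW _ f_fE)
  Ig (aeW _ (fun x n Dx => f_g n x Dx)).
by split=> //; apply: fine_cvg; rewrite fineK //; exact: integrable_fin_num If.
Qed.

End bounded_measurable.

Lemma cvg_sumr (R : realType) (I : Type) (s : seq I) (p : pred I)
    (F : I -> nat -> R) (l : I -> R) :
  (forall i, p i -> F i n @[n --> \oo] --> l i) ->
  \sum_(i <- s | p i) F i n @[n --> \oo] --> \sum_(i <- s | p i) l i.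
Proof.
move=> Fl; elim: s => [|a s ih].
  rewrite big_nil (_ : (fun n => _) = fun=> 0); first exact: cvg_cst.
  by apply/funext => n; rewrite big_nil.
rewrite big_cons (_ : (fun n => _) = fun n => if p a
  then F a n + \sum_(i <- s | p i) F i n else \sum_(i <- s | p i) F i n).
  by case: (boolP (p a)) => // pa; apply: (@cvgD _ R) => //; exact: Fl.
by apply/funext => n; rewrite big_cons.
Qed.

(** [N] takes countably many values, so a preimage splits into countably many measurable pieces on
    which the index is fixed. *)
Lemma measurable_random_index d1 (T1 : measurableType d1) (R : realType)
    (N : T1 -> nat) (F : nat -> T1 -> R) :
  measurable_fun setT N -> (forall m, measurable_fun setT (F m)) ->
  measurable_fun setT (fun w => F (N w) w).
Proof.
move=> mN mF _ Y mY; rewrite setTI.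
have -> : (fun w => F (N w) w) @^-1` Y = \bigcup_m (N @^-1` [set m] `&` F m
  @^-1` Y).
  by apply/seteqP; split=> [w Yw|w [m _ [/= <-]]//]; exists (N w).
apply: bigcup_measurable => m _; apply: measurableI.
  by rewrite -[X in measurable X]setTI; exact: mN.
by rewrite -[X in measurable X]setTI; exact: mF.
Qed.

(** * Extension from half-lines to Borel functions *)

Section Borel_extension.
Context d1 (T1 : measurableType d1) d2 (T2 : measurableType d2) (R : realType).
Variables (m1 : {measure set T1 -> \bar R}) (m2 : {measure set T2 -> \bar R}).
Variables (W1 : T1 -> R) (W2 : T2 -> R) (x1 : T1 -> R) (x2 : T2 -> R).
Hypothesis (I1 : m1.-integrable setT (EFin \o W1)).
Hypothesis (I2 : m2.-integrable setT (EFin \o W2)).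
Hypothesis (mx1 : measurable_fun setT x1) (mx2 : measurable_fun setT x2).

Let bh1 (h : R -> R) : bounded_measurable setT h -> bounded_measurable setT (h
  \o x1).
Proof.
move=> [mh [K hK]]; split; first exact: measurableT_comp.
by exists K => x _; exact: hK.
Qed.

Let bh2 (h : R -> R) : bounded_measurable setT h -> bounded_measurable setT (h
  \o x2).
Proof.
move=> [mh [K hK]]; split; first exact: measurableT_comp.
by exists K => x _; exact: hK.
Qed.

Let agree (h : R -> R) :=
  \int[m1]_w (W1 w * h (x1 w)) = \int[m2]_w (W2 w * h (x2 w)).

Let Ih1 (h : R -> R) : bounded_measurable setT h ->
  m1.-integrable setT (EFin \o (fun w => W1 w * h (x1 w))).
Proof. by move=> /bh1 bh; exact: (integrable_bounded_mulr _ I1 bh). Qed.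

Let Ih2 (h : R -> R) : bounded_measurable setT h ->
  m2.-integrable setT (EFin \o (fun w => W2 w * h (x2 w))).
Proof. by move=> /bh2 bh; exact: (integrable_bounded_mulr _ I2 bh). Qed.

Let agree_eq h h' : h =1 h' -> agree h -> agree h'.
Proof. by move=> /funext ->. Qed.

Let agreeZ c (h : R -> R) : bounded_measurable setT h -> agree h ->
  agree (fun x => c * h x).
Proof.
move=> bh; rewrite /agree => e.
under eq_Rintegral do rewrite mulrCA.
under [RHS]eq_Rintegral do rewrite mulrCA.
by rewrite !RintegralZl ?e//; [exact: Ih2|exact: Ih1].
Qed.

Let agreeD (h h' : R -> R) : bounded_measurable setT h -> bounded_measurable
  setT h' ->
  agree h -> agree h' -> agree (fun x => h x + h' x).
Proof.
move=> bh bh'; rewrite /agree => e e'.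
under eq_Rintegral do rewrite mulrDr.
under [RHS]eq_Rintegral do rewrite mulrDr.
by rewrite !RintegralD ?e ?e'//; [exact: Ih2|exact: Ih2|exact: Ih1|exact: Ih1].
Qed.

Let agree0 : agree (fun=> 0).
Proof.
rewrite /agree; under eq_Rintegral do rewrite mulr0.
under [RHS]eq_Rintegral do rewrite mulr0.
by rewrite !Rintegral_cst// !mul0r.
Qed.

Let agree_sum (s : seq nat) (F : nat -> R -> R) :
  (forall i, bounded_measurable setT (F i)) -> (forall i, agree (F i)) ->
  agree (fun x => \sum_(i <- s) F i x).
Proof.
move=> bF aF; elim: s => [|a s ih].
  by apply: agree_eq agree0 => x; rewrite big_nil.
apply: (agree_eq (h := fun x => F a x + \sum_(i <- s) F i x)).
  by move=> x; rewrite big_cons.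
by apply: agreeD => //; exact: bounded_measurable_sum.
Qed.

Let agree_lim (h_ : nat -> R -> R) h (K : R) :
  (forall n, measurable_fun setT (h_ n)) -> (forall n x, `|h_ n x| <= K) ->
  (forall x, h_ ^~ x @ \oo --> h x) -> (forall n, agree (h_ n)) -> agree h.
Proof.
move=> mh hK h_h ah.
have mW1 : measurable_fun setT W1 by apply/measurable_EFinP;
  case/integrableP: I1.
have mW2 : measurable_fun setT W2 by apply/measurable_EFinP;
  case/integrableP: I2.
have [||||_ c1] := @dominated_convergence_Rintegral _ _ _ setT m1 measurableT
  (fun n w => W1 w * h_ n (x1 w)) (fun w => W1 w * h (x1 w))
  (fun w => `|W1 w| * `|K|).
- by move=> n; apply: measurable_funM => //; exact: measurableT_comp.
- by move=> x _; apply: cvgMr; exact: h_h.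
- apply: integrable_bounded_mulr => //; last exact: bounded_measurable_cst.
  exact: (integrable_norm I1).
- by move=> n x _; rewrite normrM ler_wpM2l// (le_trans (hK _ _))// ler_norm.
have [||||_ c2] := @dominated_convergence_Rintegral _ _ _ setT m2 measurableT
  (fun n w => W2 w * h_ n (x2 w)) (fun w => W2 w * h (x2 w))
  (fun w => `|W2 w| * `|K|).
- by move=> n; apply: measurable_funM => //; exact: measurableT_comp.
- by move=> x _; apply: cvgMr; exact: h_h.
- apply: integrable_bounded_mulr => //; last exact: bounded_measurable_cst.
  exact: (integrable_norm I2).
- by move=> n x _; rewrite normrM ler_wpM2l// (le_trans (hK _ _))// ler_norm.
have e : (fun n => \int[m1]_w (W1 w * h_ n (x1 w))) =
  (fun n => \int[m2]_w (W2 w * h_ n (x2 w))) by apply/funext => n; exact: ah.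
by rewrite e in c1; exact: (cvg_unique (@Rhausdorff R) c1 c2).
Qed.

Hypothesis agreeT : \int[m1]_w W1 w = \int[m2]_w W2 w.
Hypothesis agree_le : forall b : R,
  \int[m1]_w (W1 w * (x1 w <= b)%R%:R) = \int[m2]_w (W2 w * (x2 w <= b)%R%:R).

Let agree1 : agree (fun=> 1).
Proof.
rewrite /agree; under eq_Rintegral do rewrite mulr1.
by under [RHS]eq_Rintegral do rewrite mulr1.
Qed.

Let agreeC (A : set R) : measurable A -> agree \1_A -> agree \1_(~` A).
Proof.
move=> mA aA; have bA := bounded_measurable_indic R setT mA.
apply: (agree_eq (h := fun x => 1 + -1 * \1_A x)).
  move=> x; rewrite !indicE in_setC.
  by case: (x \in A); rewrite ?mulr1 ?mulr0 ?addr0 ?subrr.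
apply: agreeD => //; [exact: bounded_measurable_cst| |exact: agreeZ].
by apply: bounded_measurableM => //; exact: bounded_measurable_cst.
Qed.

(** The half-lines ]b, +oo[ form a pi-system generating the Borel sets, and agreement passes to
    complements and to countable disjoint unions. In the latter case the partial sums are themselves
    indicators, hence bounded by 1, and are eventually constant at each point. *)
Let agree_indic (A : set R) : measurable A -> agree \1_A.
Proof.
have mG : @measurable _ (measurableTypeR R) = <<s @RGenOInfty.G R >>.
  exact: RGenOInfty.measurableE.
move=> mA; have {}mA : <<s @RGenOInfty.G R >> A by rewrite -mG; exact: mA.
have mI (F : nat -> set R) : (forall n, measurable (F n)) ->
    forall n, bounded_measurable setT (\1_(F n) : R -> R).
  by move=> mF n; exact: bounded_measurable_indic.
move: A mA.
apply: (@dynkin_induction _ (measurableTypeR R) _ (fun A => agree \1_A) mG).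
- move=> _ _ [a ->] [b ->]; exists (Num.max a b).
  by apply/seteqP; split=> x /=; rewrite !in_itv/= !andbT gt_max;
    [move=> [-> ->]|move=> /andP[]].
- by apply: agree_eq agree1 => x; rewrite indicT.
- move=> _ [b ->]; rewrite -setCitvl; apply: agreeC => //.
  rewrite /agree; under eq_Rintegral do rewrite indicE mem_setE in_itv/=.
  by under [RHS]eq_Rintegral do rewrite indicE mem_setE in_itv/=.
- by move=> A mA; exact: agreeC.
- move=> F mF tF aF.
  have sumF n x : \sum_(i <- iota 0 n) \1_(F i) x = \1_(\big[setU/set0]_(i < n)
    F i) x :> R.
    rewrite -{1}(subn0 n) -/(index_iota 0 n) big_mkord.
    elim: n => [|n ih]; first by rewrite !big_ord0 indic0.
    rewrite !big_ord_recr/= ih; have : [disjoint \big[setU/set0]_(i < n) F i &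
      F n].
      apply/disj_setPS => y [] /=; rewrite -bigcup_mkord => -[k /= kn Fk Fn].
      have kE : k = n by apply: (tF k n) => //; exists y.
      by rewrite kE ltnn in kn.
    move=> /disj_setPS dF; rewrite !indicE in_setU.
    case: (boolP (x \in F n)) => [xn|]; rewrite ?orbF ?addr0//=.
    case: (boolP (x \in \big[setU/set0]_(i < n) F i)) => [xi|];
      rewrite ?add0r//.
    by exfalso; apply: (dF x); split; exact: set_mem.
  apply: (@agree_lim (fun n x => \sum_(i <- iota 0 n) \1_(F i) x) _ 1).
  + by move=> n; have [] := bounded_measurable_sum (iota 0 n) (fun i (_ :
      xpredT i) => mI F mF i).
  + by move=> n x; rewrite sumF indicE; case: (_ \in _);
      rewrite ?normr1 ?normr0.
  + move=> x; apply: cvg_near_cst.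
    have [[k _ Fk]|nF] := pselect ((\bigcup_k F k) x).
      exists k.+1 => // n /= kn; rewrite sumF !indicE !mem_set//;
        first by exists k.
      by rewrite -bigcup_mkord; exists k.
    near=> n; rewrite sumF !indicE (memNset nF) memNset//.
    by rewrite -bigcup_mkord => -[k _ Fk]; apply: nF; exists k.
  + by move=> n; apply: agree_sum => //; exact: mI.
Unshelve. all: by end_near. Qed.

Import HBNNSimple.

Let agree_ge0 (h : R -> R) (K : R) : measurable_fun setT h -> (forall x, 0 <= h
  x <= K) ->
  agree h.
Proof.
move=> mh hK; have mEh : measurable_fun setT (EFin \o h) by
  exact/measurable_EFinP.
pose h_ := nnsfun_approx measurableT mEh.
have h0 x : setT x -> (0 <= (EFin \o h) x)%E.
  by move=> _; rewrite lee_fin; case/andP: (hK x).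
have h_h x : h_ ^~ x @ \oo --> h x.
  have := @cvg_nnsfun_approx _ _ _ setT measurableT _ mEh h0 x I.
  by move=> /fine_cvgP[_]; apply: cvg_trans; apply: near_eq_cvg; exact: nearW.
have h_le n x : h_ n x <= h x.
  have nd : nondecreasing_seq (h_ ^~ x).
    by move=> m p mp; have /lefP := nd_nnsfun_approx measurableT mEh mp; exact.
  rewrite -(cvg_lim _ (h_h x))//; apply: nondecreasing_cvgn_le => //.
  by apply/cvg_ex; eexists; exact: h_h.
apply: (@agree_lim h_ _ K) => //.
- move=> n x; rewrite ger0_norm//; apply: le_trans (h_le n x) _.
  by case/andP: (hK x).
- move=> n; have [r] : exists r : seq R, h_ n =1 fun x => \sum_(i <- iota 0
    (size r)) r`_i * \1_(h_ n @^-1` [set r`_i]) x.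
    exists (fset_set (range (h_ n))) => x.
    rewrite fimfunEord -(big_mkord xpredT (fun i => (fset_set (range (h_
      n)))`_i *
      \1_(h_ n @^-1` [set (fset_set (range (h_ n)))`_i]) x)).
    by rewrite /index_iota subn0.
  move=> /fsym rE; apply: agree_eq rE _.
  have mI i : measurable (h_ n @^-1` [set r`_i]) by [].
  apply: agree_sum => i; last first.
    by apply: agreeZ; [exact: bounded_measurable_indic|exact: agree_indic].
  by apply: bounded_measurableM; [exact: bounded_measurable_cst|exact:
    bounded_measurable_indic].
Qed.

(** The images under [x1] and [x2] of the signed measures with densities [W1] and [W2] have the same
    total mass and the same distribution function, hence coincide. The weights are not assumed
    nonnegative. *)
Lemma Borel_extension (h : R -> R) : bounded_measurable setT h ->
  \int[m1]_w (W1 w * h (x1 w)) = \int[m2]_w (W2 w * h (x2 w)).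
Proof.
move=> [mh [K hK]].
(* Adding [K] makes [h] nonnegative, as the approximation from below by simple functions
   requires. *)
apply: (agree_eq (h := fun x => (h x + K) + - K * 1)).
  by move=> x; rewrite mulr1 addrK.
have bc c := @bounded_measurable_cst _ _ _ (@setT R) c.
apply: agreeD; [|exact: bc| |exact: agreeZ].
  by apply: bounded_measurableD; [split=> //; exists K|exact: bc].
apply: (@agree_ge0 _ (K + K)); first exact: measurable_funD.
move=> x; have := hK x I; rewrite ler_norml => /andP[h1 h2].
by rewrite -[X in X <= _](addNr K) !lerD2r h1 h2.
Qed.

End Borel_extension.

(** * Primitives and quadratically small increments *)

(** Cutting [0, t] into [p] equal cells bounds |D t - D 0| by p C (t/p)^2 = C t^2/p, for every
    [p]. *)
Lemma quadratic_increments_eq (R : realType) (D : R -> R) (t C : R) : 0 <= t ->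
  (forall r s, 0 <= r -> r <= s -> s <= t ->
    `|D s - D r| <= C * (s - r) ^+ 2) ->
  D t = D 0.
Proof.
move=> t0 H; apply/eqP; rewrite -subr_eq0 -normr_eq0; apply/negPn/negP => D0.
have {}D0 : 0 < `|D t - D 0| by rewrite lt_def D0 normr_ge0.
set x := `|D t - D 0| in D0.
have C0 : 0 <= C * t ^+ 2.
  by have := H 0 t (lexx _) t0 (lexx _); rewrite subr0; apply: le_trans.
(* This [p] exceeds C t^2/x, which contradicts x <= C t^2/p. *)
pose p := (Num.bound (C * t ^+ 2 / x)).+1.
have p0 : 0 < p%:R :> R by rewrite ltr0n.
have Hp : x <= \sum_(0 <= i < p) C * (t / p%:R) ^+ 2.
  have -> : x = `|\sum_(0 <= i < p) (D (i.+1%:R * (t / p%:R)) - D (i%:R * (t /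
    p%:R)))|.
    rewrite (telescope_sumr (fun i => D (i%:R * (t / p%:R)))) // mul0r.
    by rewrite mulrC divfK ?gt_eqF.
  apply: le_trans (ler_norm_sum _ _ _) _.
  rewrite big_nat_cond [leRHS]big_nat_cond; apply: ler_sum => i.
  rewrite andbT => /andP[_ ip].
  have tp0 : 0 <= t / p%:R by rewrite divr_ge0// ltW.
  have -> : C * (t / p%:R) ^+ 2 =
      C * (i.+1%:R * (t / p%:R) - i%:R * (t / p%:R)) ^+ 2.
    by rewrite -mulrBl -natrB// subSnn mul1r.
  apply: H; [exact: mulr_ge0|by rewrite ler_wpM2r// ler_nat|].
  by rewrite mulrA ler_pdivrMr// mulrC ler_wpM2l// ler_nat.
move: Hp; rewrite sumr_const_nat subn0 -[C * _ *+ p]mulr_natl expr_div_n.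
have -> : p%:R * (C * (t ^+ 2 / p%:R ^+ 2)) = C * t ^+ 2 / p%:R.
  by field; rewrite gt_eqF.
rewrite ler_pdivlMr// leNgt => /negP; apply.
rewrite [x * _]mulrC -ltr_pdivrMr//; apply: lt_trans (archi_boundP _) _.
  by rewrite divr_ge0// ltW.
by rewrite ltr_nat.
Qed.

Section exponential.
Context (R : realType).
Implicit Types x a b : R.

(** By 1 + y <= e^y at y = -x and y = x, the product lies between 1 - x^2 and 1. Its distance to 1
    is also the probability that a Poisson variable of mean [x] is at least 2. *)
Lemma expR_sub_bound x : 0 <= x -> `|(1 + x) * expR (- x) - 1| <= x ^+ 2.
Proof.
move=> x0; have h1 : 1 - x <= expR (- x) by exact: expR_ge1Dx.
have h2 : (1 + x) * expR (- x) <= 1.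
  by rewrite expRN ler_pdivrMr ?expR_gt0// mul1r expR_ge1Dx.
rewrite distrC ger0_norm ?subr_ge0//.
have : (1 + x) * (1 - x) <= (1 + x) * expR (- x) by rewrite ler_wpM2l//
  addr_ge0.
have -> : (1 + x) * (1 - x) = 1 - x ^+ 2 by ring.
by rewrite lerBlDr addrC -lerBlDr.
Qed.

Lemma expRN_lipschitz a b : 0 <= a -> a <= b ->
  `|expR (- b) - expR (- a)| <= b - a.
Proof.
move=> a0 ab; have -> : expR (- b) = expR (- a) * expR (- (b - a)).
  by rewrite -expRD; congr expR; ring.
rewrite -{2}(mulr1 (expR (- a))) -mulrBr normrM.
have h1 : `|expR (- a)| <= 1 by rewrite ger0_norm ?expR_ge0// -expR0 ler_expR
  oppr_le0.
rewrite -[leRHS]mul1r; apply: ler_pM => //.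
have h2 := expR_ge1Dx (- (b - a)).
have h3 : expR (- (b - a)) <= 1 by rewrite -expR0 ler_expR oppr_le0 subr_ge0.
by rewrite distrC ger0_norm ?subr_ge0//; lra.
Qed.

End exponential.

Section primitive.
Context (R : realType).
Local Notation mu := (@lebesgue_measure R).
Implicit Types (u w : R -> R) (r s t T : R).

Definition primitive w t : R := \int[mu]_(s in `[0, t]) w s.

Lemma primitive0 w : primitive w 0 = 0.
Proof. by rewrite /primitive set_itv1 Rintegral_set1. Qed.

Lemma lebesgue_itv_lty (b b' : bool) r s :
  (mu [set` Interval (BSide b r) (BSide b' s)] < +oo)%E.
Proof. by rewrite lebesgue_measure_itv/=; case: ifP => _;
  rewrite -?EFinD ltry. Qed.

Lemma bounded_measurable_integrable_itv w T :
  bounded_measurable `[0, T] w -> mu.-integrable `[0, T] (EFin \o w).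
Proof.
move=> bw; apply: (@bounded_measurable_integrable _ _ R _ mu) => //.
exact: lebesgue_itv_lty.
Qed.

Lemma integrable_itvS w T t : t <= T -> mu.-integrable `[0, T] (EFin \o w) ->
  mu.-integrable `[0, t] (EFin \o w).
Proof.
by move=> tT; apply: integrableS => //; apply: subset_itvl; rewrite bnd_simp.
Qed.

Lemma integrable_itvS_oc w T r s : 0 <= r -> s <= T ->
  mu.-integrable `[0, T] (EFin \o w) -> mu.-integrable `]r, s] (EFin \o w).
Proof.
move=> r0 sT; apply: integrableS => //; apply: subset_itv; rewrite bnd_simp//.
Qed.

Lemma primitiveB w T r s : 0 <= r -> r <= s -> s <= T ->
  mu.-integrable `[0, T] (EFin \o w) ->
  primitive w s - primitive w r = \int[mu]_(x in `]r, s]) w x.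
Proof.
move=> r0 rs sT /(integrable_itvS sT) Iw.
by rewrite /primitive Rintegral_itvB// bnd_simp.
Qed.

Lemma Rintegral_oc_bound w r s (M : R) : r <= s ->
  mu.-integrable `]r, s] (EFin \o w) ->
  (forall x, r < x -> x <= s -> `|w x| <= M) ->
  `|\int[mu]_(x in `]r, s]) w x| <= M * (s - r).
Proof.
move=> rs Iw wM; apply: le_trans (le_normr_Rintegral _ Iw) _ => //.
have -> : M * (s - r) = \int[mu]_(x in `]r, s]) M.
  rewrite Rintegral_cst//= lebesgue_measure_itv/= lte_fin.
  by case: ltgtP rs => //= -> _; rewrite subrr mulr0.
apply: le_Rintegral => //.
- exact: (integrable_norm Iw).
- apply: bounded_measurable_integrable => //; first exact: lebesgue_itv_lty.
  exact: bounded_measurable_cst.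
- by move=> x /=; rewrite in_itv/= => /andP[rx xs]; exact: wM.
Qed.

Lemma primitive_lipschitz w T (K : R) : mu.-integrable `[0, T] (EFin \o w) ->
  (forall x, 0 <= x -> x <= T -> `|w x| <= K) ->
  forall r s, 0 <= r -> r <= s -> s <= T ->
  `|primitive w s - primitive w r| <= K * (s - r).
Proof.
move=> Iw wK r s r0 rs sT; rewrite (primitiveB r0 rs sT Iw).
apply: Rintegral_oc_bound => //; first exact: integrable_itvS_oc Iw.
by move=> x rx xs; apply: wK; [exact/ltW/(le_lt_trans r0)|exact: le_trans sT].
Qed.

Lemma bounded_measurable_primitive w T : mu.-integrable `[0, T] (EFin \o w) ->
  bounded_measurable `[0, T] (primitive w).
Proof.
move=> Iw; split; last first.
  exists (\int[mu]_(s in `[0, T]) `|w s|) => t /=;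
    rewrite in_itv/= => /andP[t0 tT].
  have It := integrable_itvS tT Iw.
  apply: le_trans (le_normr_Rintegral _ It) _ => //.
  have In : mu.-integrable `[0, T] (EFin \o (fun s => `|w s|)) by exact:
    integrable_norm Iw.
  rewrite -/(primitive _ t) -/(primitive _ T) -subr_ge0 (primitiveB t0 tT (lexx
    _) In).
  exact: Rintegral_ge0.
have [T0|T0] := leP 0 T; last by rewrite set_itv_ge ?bnd_simp -?ltNge//;
  exact: measurable_fun_set0.
have := parameterized_integral_continuous T0 Iw.
by apply: subspace_continuous_measurable_fun.
Qed.

Lemma eq_primitive u w t : (forall s, 0 <= s -> s <= t -> u s = w s) ->
  primitive u t = primitive w t.
Proof.
by move=> uw; apply: eq_Rintegral => s; rewrite inE/= in_itv/= => /andP[];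
  exact: uw.
Qed.

Lemma primitiveZ (c : R) w t : mu.-integrable `[0, t] (EFin \o w) ->
  primitive (fun s => c * w s) t = c * primitive w t.
Proof. by move=> Iw; rewrite /primitive RintegralZl. Qed.

Lemma dominated_convergence_primitive (w_ : nat -> R -> R) w u t :
  (forall n, measurable_fun `[0, t] (w_ n)) ->
  (forall s, 0 <= s -> s <= t -> w_ n s @[n --> \oo] --> w s) ->
  mu.-integrable `[0, t] (EFin \o u) ->
  (forall n s, 0 <= s -> s <= t -> `|w_ n s| <= u s) ->
  primitive (w_ n) t @[n --> \oo] --> primitive w t.
Proof.
move=> mw_ w_w Iu w_u.
have [||||_ //] := @dominated_convergence_Rintegral _ _ R _ mu
  (measurable_itv `[0, t]) w_ w u.
- exact: mw_.
- by move=> s /=; rewrite in_itv/= => /andP[]; exact: w_w.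
- exact: Iu.
- by move=> n s /=; rewrite in_itv/= => /andP[]; exact: w_u.
Qed.

(* The increments of [e^{-ct} S t - \int_0^t e^{-cs} psi s ds] are quadratically
   small, which avoids differentiating [S] when [psi] is merely measurable. *)
Lemma linear_integral_equation (S psi : R -> R) (a c T : R) : 0 <= c ->
  bounded_measurable `[0, T] psi -> bounded_measurable `[0, T] S ->
  (forall t, 0 <= t -> t <= T -> S t = a + primitive psi t + c * primitive S t)
    ->
  forall t, 0 <= t -> t <= T ->
  expR (- (c * t)) * S t = a + primitive (fun s => expR (- (c * s)) * psi s) t.
Proof.
move=> c0 bpsi bS HS t t0 tT.
have [mpsi [K1 psiK]] := bpsi; have [mS [K2 SK]] := bS.
have I0T x : 0 <= x -> x <= T -> `[0, T]%classic x by rewrite /= in_itv/= => ->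
  ->.
have K10 : 0 <= K1 by apply: le_trans (psiK t (I0T _ t0 tT)).
have K20 : 0 <= K2 by apply: le_trans (SK t (I0T _ t0 tT)).
have bexp : bounded_measurable `[0, T] (fun s => expR (- (c * s))).
  split; last exists 1.
    apply: measurable_funTS; apply: measurableT_comp => //.
    by apply: measurable_funN; exact: measurable_funM.
  move=> x /=; rewrite in_itv/= => /andP[x0 _]; rewrite ger0_norm ?expR_ge0//.
  by rewrite -expR0 ler_expR oppr_le0 mulr_ge0.
have bep := bounded_measurableM bexp bpsi.
have Ip := bounded_measurable_integrable_itv bpsi.
have IS := bounded_measurable_integrable_itv bS.
have Iep := bounded_measurable_integrable_itv bep.
(* The equation itself makes [S] Lipschitz, with this constant. *)
pose L := K1 + c * K2.
have SL r s : 0 <= r -> r <= s -> s <= T -> `|S s - S r| <= L * (s - r).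
  move=> r0 rs sT; have s0 := le_trans r0 rs; have rT := le_trans rs sT.
  rewrite !HS//.
  have -> : a + primitive psi s + c * primitive S s -
    (a + primitive psi r + c * primitive S r) =
    (primitive psi s - primitive psi r) + c * (primitive S s - primitive S r)
      by ring.
  apply: le_trans (ler_normD _ _) _; rewrite mulrDl lerD//.
    by apply: (primitive_lipschitz Ip) => // x x0 xT; apply: psiK; exact: I0T.
  rewrite normrM ger0_norm// -mulrA ler_wpM2l//.
  by apply: (primitive_lipschitz IS) => // x x0 xT; apply: SK; exact: I0T.
pose D t := expR (- (c * t)) * S t - primitive (fun s => expR (- (c * s)) * psi
  s) t.
suff : D t = D 0.
  rewrite /D primitive0 mulr0 oppr0 expR0 mul1r addr0 (HS 0)//;
    last exact: le_trans tT.
  by rewrite !primitive0 mulr0 !addr0 => <-; rewrite subrK.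
(* [c * K1] and [c * L] bound the two parts of [u] below; [K2 * c ^+ 2] comes from
   [expR_sub_bound]. *)
apply: (@quadratic_increments_eq _ D t (c * K1 + c * L + K2 * c ^+ 2)) => // r
  s r0 rs st.
have s0 := le_trans r0 rs; have sT := le_trans st tT; have rT := le_trans rs sT.
have bc k := @bounded_measurable_cst _ _ _ `[0, T]%classic (k : R).
(* The error made on the cell by freezing the exponential at [s] and [S] at [r]. It is of order s -
   r, so its integral is of order (s - r)^2. *)
pose u x := (expR (- (c * s)) - expR (- (c * x))) * psi x +
            c * expR (- (c * s)) * (S x - S r).
have Iu1 : mu.-integrable `[0, T] (EFin \o (fun x => expR (- (c * s)) * psi x)).
  by apply: bounded_measurable_integrable_itv; exact: bounded_measurableM.
have Iu2 : mu.-integrable `[0, T] (EFin \o (fun x => c * expR (- (c * s)) * S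
  x)).
  by apply: bounded_measurable_integrable_itv; exact: bounded_measurableM.
have Iu3 : mu.-integrable `[0, T] (EFin \o (fun x => c * expR (- (c * s)) * S
  r)).
  exact: bounded_measurable_integrable_itv.
have oc v : mu.-integrable `[0, T] (EFin \o v) -> mu.-integrable `]r, s] (EFin
  \o v).
  by move=> Iv; exact: integrable_itvS_oc Iv.
have ocD v w : mu.-integrable `]r, s] (EFin \o v) -> mu.-integrable `]r, s]
  (EFin \o w) ->
    mu.-integrable `]r, s] (EFin \o (fun x => v x + w x)).
  by move=> Iv Iw; apply: integrable_realD.
have ocB v w : mu.-integrable `]r, s] (EFin \o v) -> mu.-integrable `]r, s]
  (EFin \o w) ->
    mu.-integrable `]r, s] (EFin \o (fun x => v x - w x)).
  by move=> Iv Iw; apply: integrable_realB.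
have Iu12 := ocD _ _ (oc _ Iu1) (oc _ Iu2).
have Iu123 := ocB _ _ Iu12 (oc _ Iep).
have Iu1234 := ocB _ _ Iu123 (oc _ Iu3).
have uE x : u x = expR (- (c * s)) * psi x + c * expR (- (c * s)) * S x -
  expR (- (c * x)) * psi x - c * expR (- (c * s)) * S r by rewrite /u; ring.
have Iu : mu.-integrable `]r, s] (EFin \o u).
  by apply: eq_integrable Iu1234 => // x _; rewrite /= uE.
have intu : \int[mu]_(x in `]r, s]) u x =
    expR (- (c * s)) * (S s - S r) -
    (primitive (fun s => expR (- (c * s)) * psi s) s -
     primitive (fun s => expR (- (c * s)) * psi s) r) -
    c * expR (- (c * s)) * S r * (s - r).
  under eq_Rintegral do rewrite uE.
  rewrite RintegralB//; last exact: oc Iu3.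
  rewrite RintegralB//; last exact: oc Iep.
  rewrite RintegralD//; [|exact: oc Iu1|exact: oc Iu2].
  rewrite RintegralZl//; last exact: oc Ip.
  rewrite RintegralZl//; last exact: oc IS.
  rewrite -(primitiveB r0 rs sT Ip) -(primitiveB r0 rs sT IS) -(primitiveB r0
    rs sT Iep).
  rewrite Rintegral_cst//= lebesgue_measure_itv/= lte_fin.
  have -> : fine (if r < s then (s%:E - r%:E)%E else 0%E) = s - r.
    by case: ltgtP rs => //= -> _; rewrite subrr.
  by rewrite (HS s)// (HS r)//; ring.
have -> : D s - D r = \int[mu]_(x in `]r, s]) u x +
    S r * (expR (- (c * r)) * ((1 + c * (s - r)) * expR (- (c * (s - r))) - 1)).
  have e : expR (- (c * s)) = expR (- (c * r)) * expR (- (c * (s - r))).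
    by rewrite -expRD; congr expR; ring.
  by rewrite intu /D e; ring.
apply: le_trans (ler_normD _ _) _; rewrite [leRHS]mulrDl; apply: lerD.
  rewrite expr2 mulrA; apply: Rintegral_oc_bound => // x rx xs.
  have x0 : 0 <= x by exact/ltW/(le_lt_trans r0).
  have xT := le_trans xs sT.
  rewrite /u; apply: le_trans (ler_normD _ _) _; rewrite [leRHS]mulrDl;
    apply: lerD.
    rewrite normrM [leRHS]mulrAC; apply: ler_pM => //; last by apply: psiK;
      exact: I0T.
    apply: le_trans (expRN_lipschitz _ _) _; rewrite ?mulr_ge0 ?ler_wpM2l//.
    by rewrite -mulrBr ler_wpM2l// lerB// ltW.
  rewrite !normrM (ger0_norm c0) (ger0_norm (expR_ge0 _)) -!mulrA ler_wpM2l//.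
  rewrite -[leRHS]mul1r; apply: ler_pM; rewrite ?expR_ge0//.
    by rewrite -expR0 ler_expR oppr_le0 mulr_ge0.
  apply: le_trans (SL _ _ r0 (ltW rx) xT) _; apply: ler_wpM2l.
    by rewrite /L addr_ge0// mulr_ge0.
  by rewrite lerB.
rewrite -mulrA -exprMn normrM; apply: ler_pM => //; first by apply: SK;
  exact: I0T.
rewrite normrM -[leRHS]mul1r; apply: ler_pM => //.
  by rewrite ger0_norm ?expR_ge0// -expR0 ler_expR oppr_le0 mulr_ge0.
by apply: expR_sub_bound; rewrite mulr_ge0// subr_ge0.
Qed.

End primitive.

(** * The moment recursions *)

Section moment_recursions.
Context (R : realType) (lambda : R).
Hypothesis lambda_gt0 : 0 < lambda.
Local Notation mu := (@lebesgue_measure R).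
Implicit Types (g : R -> R) (T t s : R).

(* [lambda ^+ m * expR (- lambda * t) * jump_moment g m n t] will be the
   expectation of [Y_t ^+ n] on the event that exactly [m] jumps occur before
   [t]. *)
Fixpoint jump_moment g (m n : nat) t : R :=
  if m is m'.+1 then
    n.+1%:R^-1 *
    \sum_(j < n.+1) primitive (fun s => g s ^+ (n - j) * jump_moment g m' j s) t
  else (n == 0)%:R.

(** The factor of the chain integrand that belongs to one step from j = q_(l-1) to n = q_l. *)
Definition chain_weight g (n j : nat) s : R :=
  g s ^+ (n - j) * expR (lambda * s * ((1 + j)%:R^-1 - (1 + n)%:R^-1)) /
  (1 + n)%:R.

(** The sum of the iterated integrals over all strict chains of [k] steps from 0 to [n], organised
    by the last step from [j] to [n]. *)
Fixpoint chain_moment g (k n : nat) t : R :=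
  if k is k'.+1 then
    \sum_(j < n) primitive (fun s => chain_weight g n j s * chain_moment g k' j
      s) t
  else (n == 0)%:R.

(** The sum starts at k = 0, which contributes only for n = 0, so that the recursion over [n] has
    its base case. *)
Definition chain_sum g (n : nat) t : R :=
  \sum_(0 <= k < n.+1) lambda ^+ k * chain_moment g k n t.

(** A strictly increasing chain of [k] steps from 0 ends at [k] or above. *)
Lemma chain_moment_small g k n t : (n < k)%N -> chain_moment g k n t = 0.
Proof.
elim: k n t => [//|k ih] n t nk /=; apply: big1 => j _.
rewrite /primitive (@eq_Rintegral _ _ _ _ _ (fun=> 0)).
  by rewrite Rintegral_cst// mul0r.
by move=> s _; rewrite ih ?mulr0//; exact: leq_trans (ltn_ord j) _.
Qed.

Section integrable.
Variables (g : R -> R) (n0 : nat) (T : R).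
Hypothesis Ig : forall i, (i <= n0)%N ->
  mu.-integrable `[0, T] (EFin \o (fun s => g s ^+ i)).

Lemma integrable_chain_weight n j : (n <= n0)%N ->
  mu.-integrable `[0, T] (EFin \o chain_weight g n j).
Proof.
move=> nn0.
pose h s := expR (lambda * s * ((1 + j)%:R^-1 - (1 + n)%:R^-1)) / (1 + n)%:R.
have bh : bounded_measurable `[0, T] h.
  apply: bounded_measurableM; last exact: bounded_measurable_cst.
  split.
    apply: measurable_funTS; apply: measurableT_comp => //.
    by apply: measurable_funM => //; exact: measurable_funM.
  exists (expR (lambda * T)) => s /=; rewrite in_itv/= => /andP[s0 sT].
  rewrite ger0_norm ?expR_ge0// ler_expR -mulrA (ler_wpM2l (ltW lambda_gt0))//.
  have i1 (i : nat) : 0 <= ((1 + i)%:R^-1 : R) <= 1.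
    by rewrite invr_ge0 ler0n/= invf_le1 ?ltr0n ?ler1n.
  have /andP[a0 a1] := i1 j; have /andP[b0 b1] := i1 n.
  apply: le_trans sT; rewrite -[leRHS]mulr1 ler_wpM2l//; lra.
have In : (n - j <= n0)%N by exact: leq_trans (leq_subr _ _) nn0.
have := integrable_bounded_mulr _ (Ig In) bh; move=> /(_ (measurable_itv _)).
by apply: eq_integrable => // s _; rewrite /= /chain_weight /h mulrA.
Qed.

Lemma bounded_measurable_chain_moment k n : (n <= n0)%N ->
  bounded_measurable `[0, T] (chain_moment g k n).
Proof.
elim: k n => [|k ih] n nn0 /=; first exact: bounded_measurable_cst.
apply: bounded_measurable_sum => j _; apply: bounded_measurable_primitive.
apply: integrable_bounded_mulr => //; first exact: integrable_chain_weight.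
by apply: ih; apply: leq_trans nn0; exact: ltnW.
Qed.

Lemma integrable_chain_term k n (j : 'I_n) : (n <= n0)%N ->
  mu.-integrable `[0, T]
    (EFin \o (fun s => chain_weight g n j s * chain_moment g k j s)).
Proof.
move=> nn0; apply: integrable_bounded_mulr => //.
  exact: integrable_chain_weight.
by apply: bounded_measurable_chain_moment; apply: leq_trans nn0; exact: ltnW.
Qed.

(** Removing the last step from [j] to [n] of a nonempty chain leaves a chain to [j] and costs one
    factor [lambda]. *)
Lemma chain_sumE n t : (n <= n0)%N -> t <= T ->
  chain_sum g n t = (n == 0)%:R +
    \sum_(j < n) lambda * primitive (fun s => chain_weight g n j s * chain_sum
      g j s) t.
Proof.
move=> nn0 tT; rewrite /chain_sum big_nat_recl// expr0 mul1r /=; congr (_ + _).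
under eq_bigr do rewrite mulr_sumr.
rewrite exchange_big/=; apply: eq_bigr => j _.
have It k := integrable_itvS tT (@integrable_chain_term k n j nn0).
transitivity (primitive (fun s => \sum_(0 <= k < n)
    lambda ^+ k.+1 * (chain_weight g n j s * chain_moment g k j s)) t).
  rewrite /primitive Rintegral_sum//.
    by apply: eq_bigr => k _; rewrite RintegralZl//; exact: It.
  by move=> k _; apply: integrable_bounded_mull => //;
    exact: bounded_measurable_cst.
rewrite -primitiveZ; last first.
  apply: integrable_itvS tT _; apply: integrable_bounded_mulr => //.
    exact: integrable_chain_weight.
  apply: bounded_measurable_sum => k _; apply: bounded_measurableM.
    exact: bounded_measurable_cst.
  by apply: bounded_measurable_chain_moment; apply: leq_trans nn0; exact: ltnW.
apply: eq_primitive => s _ _.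
(* Chains to [j] have at most [j] steps, so the terms with k > j vanish and what is left is
   [chain_sum g j]. *)
rewrite (@big_cat_nat _ _ _ j.+1)//= [X in _ + X]big_nat_cond.
rewrite [X in _ + X]big1 ?addr0.
  by rewrite !mulr_sumr; apply: eq_bigr => k _; rewrite exprS; ring.
by move=> k /andP[/andP[jk _] _]; rewrite chain_moment_small// !mulr0.
Qed.

Lemma bounded_measurable_chain_sum n : (n <= n0)%N ->
  bounded_measurable `[0, T] (chain_sum g n).
Proof.
move=> nn0; apply: bounded_measurable_sum => k _; apply: bounded_measurableM.
  exact: bounded_measurable_cst.
exact: bounded_measurable_chain_moment.
Qed.

End integrable.

Section bounded.
Variables (g : R -> R) (T : R).
Hypothesis bg : bounded_measurable `[0, T] g.

Lemma bounded_measurable_jump_moment m n :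
  bounded_measurable `[0, T] (jump_moment g m n).
Proof.
elim: m n => [|m ih] n /=; first exact: bounded_measurable_cst.
apply: bounded_measurableM; first exact: bounded_measurable_cst.
apply: bounded_measurable_sum => j _; apply: bounded_measurable_primitive.
apply: bounded_measurable_integrable_itv; apply: bounded_measurableM => //.
exact: bounded_measurableX.
Qed.

(** For m > 0 these are combinations of primitives of bounded functions. The estimate serves to
    freeze the moment at the left end of a small cell. *)
Lemma jump_moment_lipschitz m n : exists L, forall r s,
  0 <= r -> r <= s -> s <= T ->
  `|jump_moment g m n s - jump_moment g m n r| <= L * (s - r).
Proof.
case: m => [|m].
  by exists 0 => r s _ _ _; rewrite subrr normr0 mul0r.
have H (j : 'I_n.+1) : exists K, forall r s, 0 <= r -> r <= s -> s <= T ->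
    `|primitive (fun s => g s ^+ (n - j) * jump_moment g m j s) s -
      primitive (fun s => g s ^+ (n - j) * jump_moment g m j s) r|
        <= K * (s - r).
  have b : bounded_measurable `[0, T] (fun s => g s ^+ (n - j) * jump_moment g
    m j s).
    apply: bounded_measurableM; [exact: bounded_measurableX|exact:
      bounded_measurable_jump_moment].
  have [_ [K hK]] := b; exists K => r s r0 rs sT.
  apply: (primitive_lipschitz (bounded_measurable_integrable_itv b)) => // x x0
    xT.
  by apply: hK; rewrite /= in_itv/= x0 xT.
have [K hK] := choice H.
exists (n.+1%:R^-1 * \sum_(j < n.+1) K j) => r s r0 rs sT.
rewrite /= -mulrBr normrM ger0_norm ?invr_ge0// -mulrA ler_wpM2l ?invr_ge0//.
rewrite -sumrB; apply: le_trans (ler_norm_sum _ _ _) _.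
by rewrite mulr_suml; apply: ler_sum => j _; exact: hK.
Qed.

Variable S : nat -> R -> R.
Hypothesis SB : forall n, exists B, forall p t, 0 <= t -> t <= T ->
  `|\sum_(0 <= m < p) lambda ^+ m * jump_moment g m n t| <= B.
Hypothesis S_lim : forall n t, 0 <= t -> t <= T ->
  \sum_(0 <= m < p) lambda ^+ m * jump_moment g m n t @[p --> \oo] --> S n t.

Let bp p n : bounded_measurable `[0, T]
  (fun t => \sum_(0 <= m < p) lambda ^+ m * jump_moment g m n t).
Proof.
apply: bounded_measurable_sum => m _; apply: bounded_measurableM.
  exact: bounded_measurable_cst.
exact: bounded_measurable_jump_moment.
Qed.

Lemma bounded_measurable_jump_series n : bounded_measurable `[0, T] (S n).
Proof.
split.
  apply: (@measurable_fun_cvg _ _ _ _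
    (fun p t => \sum_(0 <= m < p) lambda ^+ m * jump_moment g m n t)).
    by move=> p; case: (bp p n).
  by move=> t /=; rewrite in_itv/= => /andP[]; exact: S_lim.
have [B hB] := SB n; exists B => t /=; rewrite in_itv/= => /andP[t0 tT].
have c : `|\sum_(0 <= m < p) lambda ^+ m * jump_moment g m n t|
  @[p --> \oo] --> `|S n t|.
  by apply: cvg_norm; exact: S_lim.
rewrite -(cvg_lim (@Rhausdorff R) c); apply: limr_le.
  by apply/cvg_ex; eexists; exact: c.
by apply: nearW => p; exact: hB.
Qed.

(** The recursion of [jump_moment] expresses the partial sum with p + 1 terms by those with [p]
    terms. Since [g] is bounded and the partial sums are bounded uniformly in [p], dominated
    convergence lets [p] grow under the integrals. *)
Lemma jump_seriesE n t : 0 <= t -> t <= T ->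
  S n t = (n == 0)%:R + lambda / n.+1%:R *
    \sum_(j < n.+1) primitive (fun s => g s ^+ (n - j) * S j s) t.
Proof.
move=> t0 tT.
have c1 : \sum_(0 <= m < p.+1) lambda ^+ m * jump_moment g m n t @[p --> \oo]
    --> S n t.
  by move: (@S_lim n t t0 tT); rewrite -cvg_shiftS.
have step p : \sum_(0 <= m < p.+1) lambda ^+ m * jump_moment g m n t =
  (n == 0)%:R + lambda / n.+1%:R * \sum_(j < n.+1) primitive (fun s =>
    g s ^+ (n - j) * \sum_(0 <= m < p) lambda ^+ m * jump_moment g m j s) t.
  rewrite big_nat_recl// expr0 mul1r /=; congr (_ + _).
  under eq_bigr do rewrite mulr_sumr mulr_sumr.
  rewrite exchange_big/= mulr_sumr; apply: eq_bigr => j _.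
  have b m : bounded_measurable `[0, T] (fun s => g s ^+ (n - j) * jump_moment
    g m j s).
    by apply: bounded_measurableM; [exact: bounded_measurableX|exact:
      bounded_measurable_jump_moment].
  have Ib m := integrable_itvS tT (bounded_measurable_integrable_itv (b m)).
  rewrite (@eq_primitive _ _ (fun s => \sum_(0 <= m < p)
      lambda ^+ m * (g s ^+ (n - j) * jump_moment g m j s)) t); last first.
    by move=> s _ _; rewrite mulr_sumr; apply: eq_bigr => m _; ring.
  rewrite [in RHS]/primitive Rintegral_sum//; last first.
    by move=> m _; apply: integrable_bounded_mull => //;
      exact: bounded_measurable_cst.
  rewrite mulr_sumr; apply: eq_bigr => m _; rewrite RintegralZl//.
  by rewrite /primitive exprS; ring.
have {step} e := funext step; rewrite e in c1.
apply: (cvg_unique (@Rhausdorff R) c1) => {c1 e}.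
apply: (@cvgD _ R); first exact: cvg_cst.
apply: cvgMr; apply: cvg_sumr => j _.
have bX := bounded_measurableX (n - j) bg; have [mX [K hK]] := bX.
have [B hB] := SB j.
apply: (dominated_convergence_primitive (u := fun=> K * B)).
- move=> p; have [+ _] := bounded_measurableM bX (bp p j).
  by apply: measurable_funS => //; apply: subset_itvl; rewrite bnd_simp.
- by move=> s s0 st; apply: cvgMr; apply: S_lim => //; exact: le_trans tT.
- apply: bounded_measurable_integrable_itv; exact: bounded_measurable_cst.
- move=> p s s0 st; have sT := le_trans st tT.
  by rewrite normrM; apply: ler_pM => //; [apply: hK;
    rewrite /= in_itv/= s0|exact: hB].
Qed.

(** Strong induction on [n]. The term j = n carries the power 0 of [g], so [S n] solves a linear
    integral equation with coefficient c = lambda/(n+1) and a source [psi] made of the terms j < n.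
    Its solution, with the induction hypothesis inserted in [psi], is the recursion [chain_sumE]. *)
Lemma jump_series_chain_sum n t : 0 <= t -> t <= T ->
  S n t = expR (lambda * t / n.+1%:R) * chain_sum g n t.
Proof.
have Ig i : mu.-integrable `[0, T] (EFin \o (fun s => g s ^+ i)).
  by apply: bounded_measurable_integrable_itv; exact: bounded_measurableX.
elim/ltn_ind: n t => n ih t t0 tT; pose c := lambda / n.+1%:R.
pose psi s := \sum_(j < n) (c * g s ^+ (n - j)) * S j s.
have bcS (j : nat) : bounded_measurable `[0, T] (fun s => g s ^+ (n - j) * S j
  s).
  apply: bounded_measurableM; first exact: bounded_measurableX.
  exact: bounded_measurable_jump_series.
have bpsi : bounded_measurable `[0, T] psi.
  apply: bounded_measurable_sum => j _; apply: bounded_measurableM.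
    by apply: bounded_measurableM; [exact: bounded_measurable_cst|exact:
      bounded_measurableX].
  exact: bounded_measurable_jump_series.
have c0 : 0 <= c by rewrite divr_ge0// ltW.
have eqS s : 0 <= s -> s <= T -> S n s = (n == 0)%:R + primitive psi s + c *
  primitive (S n) s.
  move=> s0 sT; rewrite (jump_seriesE n s0 sT) -addrA; congr (_ + _).
  rewrite big_ord_recr/= mulrDr; congr (_ + _); last first.
    by congr (_ * _); apply: eq_primitive => x _ _; rewrite subnn expr0 mul1r.
  rewrite mulr_sumr /psi.
  rewrite (@eq_primitive _ _ (fun s => \sum_(j < n) c * (g s ^+ (n - j) * S j
    s))).
    have Ij (j : nat) := integrable_itvS sT (bounded_measurable_integrable_itv
      (bcS j)).
    rewrite [in RHS]/primitive Rintegral_sum//.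
      by apply: eq_bigr => j _; rewrite RintegralZl//; exact: Ij.
    by move=> j _; apply: integrable_bounded_mull => //;
      exact: bounded_measurable_cst.
  by move=> x _ _; apply: eq_bigr => j _; rewrite mulrA.
have := linear_integral_equation c0 bpsi (bounded_measurable_jump_series n) eqS
  t0 tT.
have -> : lambda * t / n.+1%:R = c * t by rewrite /c; ring.
rewrite (@chain_sumE g n T (fun i _ => Ig i) n t)//.
move=> /(congr1 (fun x => expR (c * t) * x)).
rewrite mulrA -expRD subrr expR0 mul1r => ->; congr (_ * (_ + _)).
rewrite (@eq_primitive _ _ (fun s => \sum_(j < n) lambda * (chain_weight g n j
  s * chain_sum g j s))).
  have Ij (j : 'I_n) : mu.-integrable `[0, t] (EFin \o (fun s => chain_weight g
    n j s * chain_sum g j s)).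
    apply: integrable_itvS tT _; apply: integrable_bounded_mulr => //.
      exact: (@integrable_chain_weight g n T (fun i _ => Ig i)).
    by apply: (@bounded_measurable_chain_sum g j T (fun i _ => Ig i)).
  rewrite [in LHS]/primitive Rintegral_sum//.
    by apply: eq_bigr => j _; rewrite RintegralZl//; exact: Ij.
  by move=> j _; apply: integrable_bounded_mull => //;
    exact: bounded_measurable_cst.
move=> s s0 st; rewrite /psi mulr_sumr; apply: eq_bigr => j _.
rewrite ih//; last exact: le_trans tT.
rewrite /chain_weight.
have -> : lambda * s * ((1 + j)%:R^-1 - (1 + n)%:R^-1) =
   lambda * s / j.+1%:R - c * s by rewrite /c !add1n; ring.
by rewrite expRD /c add1n; ring.
Qed.

End bounded.

End moment_recursions.

(** * Sums over chains *)

Section chain_limits.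
Context (R : realType) (lambda : R).
Hypothesis lambda_gt0 : 0 < lambda.
Local Notation mu := (@lebesgue_measure R).
Variables (g : R -> R) (g_ : nat -> R -> R) (n0 : nat) (T : R).
Hypothesis mg_ : forall p, measurable_fun setT (g_ p).
Hypothesis g_lim : forall s, g_ p s @[p --> \oo] --> g s.
Hypothesis g_le : forall p s, `|g_ p s| <= `|g s|.
Hypothesis Ig : forall i, (i <= n0)%N ->
  mu.-integrable `[0, T] (EFin \o (fun s => g s ^+ i)).

Let Ig_ p i : (i <= n0)%N ->
  mu.-integrable `[0, T] (EFin \o (fun s => g_ p s ^+ i)).
Proof.
move=> /Ig; apply: le_integrable => //.
  by apply/measurable_EFinP/measurable_funTS/measurable_funX; exact: mg_.
by move=> s _ /=; rewrite lee_fin !normrX lerXn2r ?nnegrE.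
Qed.

Let chain_weight_le p n j s :
  `|chain_weight lambda (g_ p) n j s| <= `|chain_weight lambda g n j s|.
Proof.
rewrite /chain_weight !normrM ler_wpM2r// ler_wpM2r//.
by rewrite !normrX lerXn2r ?nnegrE.
Qed.

(** The bound, uniform in [p] and in the time, is carried through the induction together with the
    limit: multiplied by the weight of [g], it is the dominating function of the next integral. *)
Let chain_moment_bound_cvg k n : (n <= n0)%N -> exists B, forall t,
  0 <= t -> t <= T ->
  (forall p, `|chain_moment lambda (g_ p) k n t| <= B) /\
  chain_moment lambda (g_ p) k n t @[p --> \oo] --> chain_moment lambda g k n t.
Proof.
elim: k n => [|k ih] n nn0.
  exists `|(n == 0)%:R| => t _ _; split=> //=; exact: cvg_cst.
have ihj (j : 'I_n) : exists B, forall t, 0 <= t -> t <= T ->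
  (forall p, `|chain_moment lambda (g_ p) k j t| <= B) /\
  chain_moment lambda (g_ p) k j t @[p --> \oo] --> chain_moment lambda g k j t.
  by apply: ih; apply: leq_trans nn0; exact: ltnW.
have [B hB] := choice ihj.
have B0 j t : 0 <= t -> t <= T -> 0 <= B j.
  by move=> t0 tT; have [+ _] := hB j t t0 tT; move=> /(_ 0%N); exact: le_trans.
have Iw (j : 'I_n) : mu.-integrable `[0, T]
    (EFin \o (fun s => `|chain_weight lambda g n j s| * B j)).
  apply: integrable_bounded_mulr => //; last exact: bounded_measurable_cst.
  by apply: integrable_norm; exact: (integrable_chain_weight lambda_gt0 Ig).
have bnd p (j : 'I_n) s : 0 <= s -> s <= T ->
    `|chain_weight lambda (g_ p) n j s * chain_moment lambda (g_ p) k j s| <=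
    `|chain_weight lambda g n j s| * B j.
  move=> s0 sT; rewrite normrM; apply: ler_pM;
    [by []|by []|exact: chain_weight_le|].
  by have [+ _] := hB j s s0 sT; exact.
exists (\sum_(j < n) primitive (fun s => `|chain_weight lambda g n j s|
  * B j) T).
move=> t t0 tT; split=> [p|] /=.
  apply: le_trans (ler_norm_sum _ _ _) _; apply: ler_sum => j _.
  have It := integrable_itvS tT (integrable_chain_term lambda_gt0 (@Ig_ p) k j
    nn0).
  apply: le_trans (le_normr_Rintegral _ It) _ => //.
  apply: (@le_trans _ _ (primitive (fun s => `|chain_weight lambda g n j s|
    * B j) t)).
    apply: le_Rintegral => //; [exact: (integrable_norm It)|exact:
      integrable_itvS tT (Iw j)|].
    by move=> s /=; rewrite in_itv/= => /andP[s0 st]; apply: bnd => //;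
      exact: le_trans tT.
  rewrite -subr_ge0 (primitiveB t0 tT (lexx _) (Iw j)).
  by apply: Rintegral_ge0 => s _; rewrite mulr_ge0// (B0 j t).
apply: cvg_sumr => j _.
apply: (dominated_convergence_primitive
  (u := fun s => `|chain_weight lambda g n j s| * B j)).
- move=> p; apply/measurable_EFinP.
  by have := integrable_itvS tT (integrable_chain_term lambda_gt0 (@Ig_ p) k j
    nn0); case/integrableP.
- move=> s s0 st; have sT := le_trans st tT; apply: cvgM;
    last by have [] := hB j s s0 sT.
  rewrite /chain_weight; do 2 (apply: cvgM; last exact: cvg_cst).
  elim: (n - j)%N => [|i ihi]; first by under eq_fun do rewrite expr0;
    exact: cvg_cst.
  by under eq_fun do rewrite exprS; rewrite exprS; apply: cvgM.
- exact: integrable_itvS tT (Iw j).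
- by move=> p s s0 st; apply: bnd => //; exact: le_trans tT.
Qed.

(** The bound serves for the integrability of the moment built on the absolute value, the limit for
    the final passage from truncations to [g]. *)
Lemma chain_sum_bound_cvg n t : (n <= n0)%N -> 0 <= t -> t <= T ->
  (exists B, forall p, `|chain_sum lambda (g_ p) n t| <= B) /\
  chain_sum lambda (g_ p) n t @[p --> \oo] --> chain_sum lambda g n t.
Proof.
move=> nn0 t0 tT.
have c : chain_sum lambda (g_ p) n t @[p --> \oo] --> chain_sum lambda g n t.
  apply: cvg_sumr => k _; apply: cvgMr.
  by have [B hB] := chain_moment_bound_cvg k nn0; have [] := hB t t0 tT.
split=> //.
have H k : exists B, forall p, `|chain_moment lambda (g_ p) k n t| <= B.
  by have [B hB] := chain_moment_bound_cvg k nn0; exists B;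
    have [] := hB t t0 tT.
have [B hB] := choice H.
exists (\sum_(0 <= k < n.+1) lambda ^+ k * B k) => p.
apply: le_trans (ler_norm_sum _ _ _) _; apply: ler_sum => k _.
by rewrite normrM normrX (gtr0_norm lambda_gt0) ler_wpM2l// exprn_ge0// ltW.
Qed.

End chain_limits.

(** Agreement is asked only at nonnegative times, because the functions [f k] are known to coincide
    only there. *)
Lemma eq_simplex_integral (R : realType) (k : nat) (t : R) (F G : seq R -> R) :
  (forall v, size v = k -> all (fun s => 0 <= s) v -> F v = G v) ->
  simplex_integral k t F = simplex_integral k t G.
Proof.
elim: k t F G => [|k ih] t F G FG /=; first exact: FG.
apply: eq_Rintegral => s; rewrite inE/= in_itv/= => /andP[s0 _].
by apply: ih => v vk v0; apply: FG; rewrite ?size_rcons ?vk// all_rcons s0.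
Qed.

(** * Iterated integrals over ordered times and chain moments *)

Section simplex.
Context (R : realType) (lambda : R).
Hypothesis lambda_gt0 : 0 < lambda.
Local Notation mu := (@lebesgue_measure R).
Variables (f : nat -> R -> R) (g : R -> R) (n0 : nat) (T : R).
Hypothesis fg : forall k s, (1 <= k)%N -> 0 <= s -> f k s = g s.
Hypothesis Ig : forall i, (i <= n0)%N ->
  mu.-integrable `[0, T] (EFin \o (fun s => g s ^+ i)).

Let V (p : seq nat) t : R :=
  simplex_integral (size p) t (chain_integrand lambda f (size p) (0%N :: p)).

Lemma chain_integrand_rcons (p : seq nat) n (v : seq R) s :
  size v = size p -> 0 <= s ->
  chain_integrand lambda f (size p).+1 (0%N :: rcons p n) (rcons v s) =
  chain_integrand lambda f (size p) (0%N :: p) v *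
  chain_weight lambda g n (last 0%N p) s.
Proof.
move=> vp s0; rewrite /chain_integrand big_nat_recr//=; congr (_ * _).
  apply: eq_big_nat => -[//|l] /andP[_ lp] /=.
  rewrite ltnS in lp; rewrite !nth_rcons vp lp.
  by case: l lp => [|l] lp //=; rewrite nth_rcons (ltnW lp).
have e : nth 0%N (0%N :: rcons p n) (size p) = last 0%N p.
  rewrite -rcons_cons nth_rcons /= ltnSn -[size p]/(size (0%N :: p)).-1.
  by rewrite nth_last.
by rewrite e !nth_rcons vp ltnn eqxx fg.
Qed.

(** The scalar [c] stands for the factor of the outermost time, which sits inside all the inner
    integrals. Pulling it out requires integrability at every level, hence the joint induction with
    boundedness. *)
Let V_spec (p : seq nat) : path ltn 0%N p -> (last 0%N p <= n0)%N ->
  bounded_measurable `[0, T] (V p) /\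
  forall t c, 0 <= t -> t <= T ->
    simplex_integral (size p) t
      (fun v => chain_integrand lambda f (size p) (0%N :: p) v * c) = V p t * c.
Proof.
elim/last_ind: p => [|p n ih].
  move=> _ _; split=> //; exact: bounded_measurable_cst.
rewrite rcons_path last_rcons => /andP[pp ln] nn0.
have [|bV HV] := ih pp; first exact: leq_trans (ltnW ln) nn0.
have E t c : t <= T -> simplex_integral (size p).+1 t (fun v =>
    chain_integrand lambda f (size p).+1 (0%N :: rcons p n) v * c) =
    primitive (fun s => chain_weight lambda g n (last 0%N p) s * V p s * c) t.
  move=> tT; apply: eq_Rintegral => s; rewrite inE/= in_itv/= => /andP[s0 st].
  rewrite [chain_weight _ _ _ _ _ * _]mulrC -mulrA -HV//;
    last exact: le_trans tT.
  apply: eq_simplex_integral => v vp v0.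
  by rewrite chain_integrand_rcons// mulrA.
have Iw : mu.-integrable `[0, T]
    (EFin \o (fun s => chain_weight lambda g n (last 0%N p) s * V p s)).
  apply: integrable_bounded_mulr => //.
  exact: (integrable_chain_weight lambda_gt0 Ig).
have E1 t : t <= T -> V (rcons p n) t =
    primitive (fun s => chain_weight lambda g n (last 0%N p) s * V p s) t.
  move=> tT; have := E t 1 tT; rewrite /V size_rcons => E1.
  transitivity (simplex_integral (size p).+1 t (fun v =>
      chain_integrand lambda f (size p).+1 (0%N :: rcons p n) v * 1)).
    by apply: eq_simplex_integral => v _ _; rewrite mulr1.
  by rewrite E1; apply: eq_primitive => s _ _; rewrite mulr1.
split.
  apply: bounded_measurable_eq (bounded_measurable_primitive Iw).
  by move=> t /=; rewrite in_itv/= => /andP[_ tT]; rewrite E1.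
move=> t c t0 tT; rewrite size_rcons E// E1// /primitive RintegralZr//.
exact: integrable_itvS tT Iw.
Qed.

Let V_rcons (p : seq nat) n t : path ltn 0%N (rcons p n) -> (n <= n0)%N ->
  0 <= t -> t <= T ->
  V (rcons p n) t =
  primitive (fun s => chain_weight lambda g n (last 0%N p) s * V p s) t.
Proof.
rewrite rcons_path => /andP[pp ln] nn0 t0 tT.
have [|bV HV] := V_spec pp; first exact: leq_trans (ltnW ln) nn0.
rewrite /V size_rcons; apply: eq_Rintegral => s.
rewrite inE/= in_itv/= => /andP[s0 st].
rewrite [chain_weight _ _ _ _ _ * _]mulrC -HV//; last exact: le_trans tT.
by apply: eq_simplex_integral => v vp v0; rewrite chain_integrand_rcons.
Qed.

(** Splitting off the last entry [n] and grouping the chains by the previous one gives the recursion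
    of [chain_moment]. [M] only bounds the entries; it stays fixed while the endpoint decreases in
    the induction. *)
Lemma sum_simplex_integral M k n t : (n < M)%N -> (n <= n0)%N ->
  0 <= t -> t <= T ->
  \sum_(p : k.-tuple 'I_M | chain_to n [seq val i | i <- p])
    simplex_integral k t (chain_integrand lambda f k (0%N :: [seq val i |
      i <- p])) =
  chain_moment lambda g k n t.
Proof.
move=> nM nn0 t0 tT; pose vals k (p : k.-tuple 'I_M) := [seq val i | i <- p].
transitivity (\sum_(p : k.-tuple 'I_M | chain_to n (vals k p)) V (vals k p) t).
  by apply: eq_bigr => p _; rewrite /V size_map size_tuple.
elim: k n t nM nn0 t0 tT => [|k ih] n t nM nn0 t0 tT.
  rewrite big_mkcond (bigD1 [tuple])//= big1 ?addr0; last first.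
    by move=> p /eqP; rewrite (tuple0 p).
  rewrite /chain_to /vals /V /= eq_sym /chain_integrand big_geq//.
  by case: eqP.
pose h (x : 'I_M * k.-tuple 'I_M) : k.+1.-tuple 'I_M := [tuple of rcons x.2
  x.1].
have hb : bijective h.
  apply: inj_card_bij; last by rewrite card_prod !card_tuple card_ord expnS.
  move=> [a p] [b q] /(congr1 val)/= /rcons_inj[pq ->].
  by congr (_, _); exact: val_inj.
rewrite (reindex h); last exact: onW_bij.
have valsE a p : vals k.+1 (h (a, p)) = rcons (vals k p) (val a) by
  rewrite /vals map_rcons.
rewrite -(pair_big_dep xpredT (fun a p => chain_to n (vals k.+1 (h (a, p))))
  (fun a p => V (vals k.+1 (h (a, p))) t))/=.
rewrite (bigD1 (Ordinal nM))//= [X in _ + X]big1 ?addr0; last first.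
  move=> a an; apply: big_pred0 => p; rewrite valsE /chain_to last_rcons.
  by apply/negbTE; rewrite negb_and -[val a == n]/(a == Ordinal nM) an orbT.
have pE p : chain_to n (vals k.+1 (h (Ordinal nM, p))) =
    path ltn 0%N (vals k p) && (last 0%N (vals k p) < n)%N.
  by rewrite valsE /chain_to last_rcons rcons_path eqxx andbT.
under eq_bigl do rewrite pE.
(* A tuple that extends to a chain to [n] is a chain to exactly one j < n, namely its last entry, or
   0 if it is empty. *)
transitivity (\sum_(p : k.-tuple 'I_M) \sum_(j < n)
    if chain_to j (vals k p) then V (rcons (vals k p) n) t else 0).
  rewrite big_mkcond; apply: eq_bigr => p _; case: ifP => [/andP[pp ln]|pl].
    rewrite (bigD1 (Ordinal ln))//= /chain_to pp eqxx valsE big1 ?addr0//.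
    move=> j jl; rewrite ifN//=; apply: contra jl => /eqP jl.
    by apply/eqP/val_inj.
  rewrite big1// => j _; rewrite ifN// /chain_to;
    apply/negP => /andP[pp /eqP lj].
  by rewrite pp lj ltn_ord in pl.
rewrite exchange_big/=; apply: eq_bigr => j _.
have jn0 : (j <= n0)%N by exact: leq_trans (ltnW (ltn_ord j)) nn0.
have jM := ltn_trans (ltn_ord j) nM.
rewrite -big_mkcond.
transitivity (\sum_(p | chain_to j (vals k p))
    primitive (fun s => chain_weight lambda g n j s * V (vals k p) s) t).
  apply: eq_bigr => p /andP[pp /eqP lj].
  by rewrite V_rcons// ?lj// rcons_path pp lj /=.
have IV p : chain_to j (vals k p) -> mu.-integrable `[0, t]
    (EFin \o (fun s => chain_weight lambda g n j s * V (vals k p) s)).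
  move=> /andP[pp /eqP lj]; apply: integrable_itvS tT _.
  apply: integrable_bounded_mulr => //.
    exact: (integrable_chain_weight lambda_gt0 Ig).
  by have [] := V_spec pp; rewrite ?lj.
rewrite -Rintegral_sum//; apply: eq_primitive => s s0 st.
by rewrite -ih// ?mulr_sumr//; exact: le_trans tT.
Qed.

End simplex.

(** * Events of the future *)

Section future_events.
Context (R : realType) (d : measure_display) (Om : measurableType d)
  (P : probability Om R) (lambda : R)
  (N : R -> {RV P >-> nat}) (T Z : nat -> {RV P >-> R}).
Hypothesis (N_poisson : poisson_process lambda N T).
Hypothesis (Z_iid : iid_uniform01 Z).
Hypothesis (ZN_indep : independent_sigma P
      (sigma_of_family [set k | (1 <= k)%N] (fun k => Z k : Om -> R))
      (sigma_of_family [set s : R | 0 <= s] (fun s : R => N s : Om -> nat))).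

Let increments_event (u : nat -> R) (J : {fset nat}) (A : nat -> set nat) : set
  Om :=
  \bigcap_(i in [set` J]) ((fun w => (N (u i.+1) w - N (u i) w)%N) @^-1` A i).

(** Index [i] refers to the mark [Z i.+1], since [Z 0] is ignored; a condition m <= i thus concerns
    the marks after the [m]-th. *)
Let marks_event (K : {fset nat}) (B : nat -> set R) : set Om :=
  \bigcap_(i in [set` K]) ((Z i.+1 : Om -> R) @^-1` B i).

(* Events determined by the increments of [N] after time [t] and by the marks
   [Z k] with [k > m]. *)
Definition future (m : nat) (t : R) (F : set Om) : Prop :=
  exists (u : nat -> R) (J : {fset nat}) (A : nat -> set nat)
         (K : {fset nat}) (B : nat -> set R),
  [/\ 0 <= t, u 0%N = t & forall i, u i <= u i.+1] /\
  [/\ forall i, i \in K -> (m <= i)%N, forall i, measurable (B i) &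
      F = increments_event u J A `&` marks_event K B].

Lemma measurable_increment (s t : R) (A : set nat) :
  measurable ((fun w => (N t w - N s w)%N) @^-1` A).
Proof.
rewrite -[X in measurable X]setTI; have : measurable_fun setT (fun w => (N t w
  - N s w)%N).
  exact: measurable_fun_subn.
exact.
Qed.

Let mono_ge0 (u : nat -> R) i : 0 <= u 0%N -> (forall i, u i <= u i.+1) -> 0 <=
  u i.
Proof. by move=> u0 um; elim: i => // i ih; apply: le_trans (um i). Qed.

(** The sample space is equipped anew with the sigma-algebra generated by the counts, so that
    membership in it becomes measurability of the increments. *)
Let increments_sigma u J A : 0 <= u 0%N -> (forall i, u i <= u i.+1) ->
  sigma_of_family [set s : R | 0 <= s] (fun s : R => N s : Om -> nat)
    (increments_event u J A).
Proof.
move=> u0 um; rewrite /sigma_of_family; set G := (X in <<s X >>).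
have mN s : 0 <= s -> measurable_fun setT (N s : g_sigma_algebraType G -> nat).
  move=> s0 _ Y mY; apply: sub_sigma_algebra; exists s => //.
  by exists Y.
have : measurable (increments_event u J A : set (g_sigma_algebraType G)).
  apply: fin_bigcap_measurable => // i _.
  rewrite -[X in measurable X]setTI.
  have : measurable_fun setT (fun w : g_sigma_algebraType G => (N (u i.+1) w -
    N (u i) w)%N).
    by apply: measurable_fun_subn; apply: mN; exact: mono_ge0.
  exact.
exact.
Qed.

Let marks_sigma K B : (forall i, measurable (B i)) ->
  sigma_of_family [set k | (1 <= k)%N] (fun k => Z k : Om -> R) (marks_event K
    B).
Proof.
move=> mB; rewrite /sigma_of_family; set G := (X in <<s X >>).
have : measurable (marks_event K B : set (g_sigma_algebraType G)).
  apply: fin_bigcap_measurable => // i _; apply: sub_sigma_algebra.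
  exists i.+1 => //; exists (B i) => //; by rewrite setTI.
exact.
Qed.

Let prob_future u J A K B : 0 <= u 0%N -> (forall i, u i <= u i.+1) ->
  (forall i, measurable (B i)) ->
  P (increments_event u J A `&` marks_event K B) =
  ((\prod_(i <- J) P ((fun w => (N (u i.+1) w - N (u i) w)%N) @^-1` A i)) *
   \prod_(i <- K) P ((Z i.+1 : Om -> R) @^-1` B i))%E.
Proof.
move=> u0 um mB; rewrite setIC ZN_indep;
  [|exact: marks_sigma|exact: increments_sigma].
rewrite muleC; congr (_ * _)%E.
  by apply: (independent_increments N_poisson).
by apply: Z_iid.1.
Qed.

Lemma future_measurable m t F : future m t F -> measurable F.
Proof.
move=> [u [J [A [K [B [_ [_ mB ->]]]]]]]; apply: measurableI.
  by apply: fin_bigcap_measurable => // i _; exact: measurable_increment.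
apply: fin_bigcap_measurable => // i _.
by rewrite -[X in measurable X]setTI; exact: measurable_funP.
Qed.

Lemma futureT m t : 0 <= t -> future m t setT.
Proof.
move=> t0; exists (fun=> t), fset0, (fun=> setT), fset0, (fun=> setT).
do 2 split=> //; rewrite /increments_event /marks_event.
by rewrite !set_fset0 !bigcap_set0 setTI.
Qed.

(** Prepending [s] to the subdivision and requiring the value [k] on its first interval gives an
    event of the same form, whose product formula has one more factor. *)
Lemma future_increment m s t k F : 0 <= s -> s <= t -> future m t F ->
  let E := [set w | (N t w - N s w)%N = k] in
  future m s (E `&` F) /\ P (E `&` F) = (P E * P F)%E.
Proof.
move=> s0 st [u [J [A [K [B [[t0 u0 um] [mK mB ->]]]]]]] E.
pose u' i := if i is i'.+1 then u i' else s.
pose J' := (0 |` [fset i.+1 | i in J])%fset.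
pose A' i := if i is i'.+1 then A i' else [set k].
have EE : E `&` (increments_event u J A `&` marks_event K B) =
    increments_event u' J' A' `&` marks_event K B.
  rewrite setIA; congr (_ `&` _); apply/seteqP; split=> w.
    move=> [Ew Jw] i /=; rewrite !inE => /orP[/eqP -> /=|].
      by rewrite u0.
    by move=> /imfsetP[j /= jJ ->]; exact: Jw.
  move=> H; split=> /=.
    by have := H 0%N; rewrite /= !inE/= u0; apply.
  move=> i /= iJ; apply: (H i.+1) => /=.
  by rewrite !inE; apply/orP; right; apply/imfsetP; exists i.
have um' i : u' i <= u' i.+1 by case: i => [|i] //=; rewrite u0.
split.
  exists u', J', A', K, B; do 2 split=> //.
rewrite EE !prob_future ?u0// muleA; congr (_ * _)%E.
rewrite /J' big_fsetU1/=; last by apply/imfsetP => -[i].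
rewrite u0; congr (_ * _)%E.
by rewrite big_imfset// => i j _ _ [].
Qed.

(** The indices in [K] are at least m + 1, so the condition on [Z m.+1] is a new factor in the
    product of probabilities. *)
Lemma future_mark m t B0 F : measurable B0 -> future m.+1 t F ->
  let E := (Z m.+1 : Om -> R) @^-1` B0 in
  future m t (E `&` F) /\ P (E `&` F) = (P E * P F)%E.
Proof.
move=> mB0 [u [J [A [K [B [[t0 u0 um] [mK mB ->]]]]]]] E.
have mnK : m \notin K by apply/negP => /mK; rewrite ltnn.
pose B' i := if i == m then B0 else B i.
have B'K i : i \in K -> B' i = B i.
  by rewrite /B'; case: eqP => // -> mk; rewrite mk in mnK.
have mB' i : measurable (B' i) by rewrite /B'; case: ifP.
have EE : E `&` (increments_event u J A `&` marks_event K B) =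
    increments_event u J A `&` marks_event (m |` K)%fset B'.
  rewrite setICA; congr (_ `&` _); apply/seteqP; split=> w.
    move=> [Ew Kw] i /=; rewrite !inE => /orP[/eqP -> /=|iK].
      by rewrite /B' eqxx.
    by rewrite B'K//; exact: Kw.
  move=> H; split=> /=.
    by have := H m; rewrite /= !inE/= /B' eqxx; apply.
  by move=> i /= iK; have := H i; rewrite /= !inE iK orbT B'K//; apply.
split.
  exists u, J, A, (m |` K)%fset, B'; do 2 split=> //.
  by move=> i; rewrite !inE => /orP[/eqP ->//|/mK /ltnW].
rewrite EE !prob_future ?u0// muleCA; congr (_ * _)%E.
rewrite big_fsetU1//= /B' eqxx; congr (_ * _)%E.
by apply: eq_big_seq => i iK; rewrite -/(B' i) B'K.
Qed.

Lemma futureS m t F : future m.+1 t F -> future m t F.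
Proof.
move=> [u [J [A [K [B [? [mK mB FE]]]]]]]; exists u, J, A, K, B.
by split=> //; split=> // i /mK /ltnW.
Qed.

(** The plain formula, without the case distinction of [poisson_pmf] on the rate. At rate 0 the
    convention 0^0 = 1 gives the unit mass at 0, which covers the increment over a degenerate
    interval. *)
Definition poisson_weight (x : R) (k : nat) : R := x ^+ k / k`!%:R * expR (- x).

Lemma increment_prob s t k : 0 < lambda -> 0 <= s -> s <= t ->
  P [set w | (N t w - N s w)%N = k] = (poisson_weight (lambda * (t - s)) k)%:E.
Proof.
move=> l0 s0; rewrite le_eqVlt => /predU1P[->|st]; last first.
  rewrite (poisson_increments N_poisson)// /poisson_pmf.
  by rewrite mulr_gt0 ?subr_gt0.
rewrite /poisson_weight subrr mulr0 oppr0 expR0 mulr1.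
case: k => [|k].
  rewrite expr0 fact0 divr1 (_ : [set _ | _] = setT) ?probability_setT//.
  by apply/seteqP; split=> // w _ /=; rewrite subnn.
rewrite expr0n mul0r (_ : [set _ | _] = set0) ?measure0//.
by apply/seteqP; split=> // w /=; rewrite subnn.
Qed.

End future_events.

(** * The law of the next jump time *)

(** [x], [y], [z] are the counts at times r <= s <= t. Between [r] and [s], the indicator of m + 1
    jumps followed by none until [t] changes by the indicator of exactly one jump in ]r, s], after
    [m] jumps and before none, unless ]r, s] contains two jumps. *)
Lemma one_jump_indicator (R : realDomainType) (x y z m : nat) :
  (x <= y)%N -> (y <= z)%N ->
  `|(y == m.+1)%:R * ((z - y)%N == 0%N)%:R - (x == m.+1)%:R * ((z - x)%N ==
    0%N)%:R
    - (x == m)%:R * (((y - x)%N == 1%N) && ((z - y)%N == 0%N))%:R| <=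
  (2 <= y - x)%N%:R :> R.
Proof.
move=> xy yz; rewrite !subn_eq0.
have [h|[h|h]] : (2 <= y - x)%N \/ y = x \/ y = x.+1 by lia.
- rewrite h; have -> : (y - x == 1)%N = false by lia.
  have -> : (z <= x)%N = false by lia.
  rewrite /= !mulr0 !subr0 -natrM ger0_norm// ler_nat.
  by case: eqP => _; case: (z <= y)%N.
- have -> : (y - x == 1)%N = false by lia.
  by rewrite h mulr0 subr0 subrr normr0.
- have -> : (y - x == 1)%N by lia.
  have -> : (z <= x)%N = false by lia.
  by rewrite h eqSS mulr0 subr0 subrr normr0.
Qed.

Section jump_expectation.
Context (R : realType) (d : measure_display) (Om : measurableType d)
  (P : probability Om R) (lambda : R)
  (N : R -> {RV P >-> nat}) (T Z : nat -> {RV P >-> R}).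
Hypothesis lambda_gt0 : 0 < lambda.
Hypothesis (N_poisson : poisson_process lambda N T).
Hypothesis (Z_iid : iid_uniform01 Z).
Hypothesis (ZN_indep : independent_sigma P
      (sigma_of_family [set k | (1 <= k)%N] (fun k => Z k : Om -> R))
      (sigma_of_family [set s : R | 0 <= s] (fun s : R => N s : Om -> nat))).

Local Notation mu := (@lebesgue_measure R).
Local Notation bm := (@bounded_measurable _ Om R setT).
Local Notation Pr F := (fine (P F)).

Lemma bounded_measurable_integrable_prob W : bm W -> P.-integrable setT (EFin
  \o W).
Proof.
apply: bounded_measurable_integrable => //.
exact: (le_lt_trans (probability_le1 P measurableT) (ltry 1)).
Qed.

Lemma Rintegral_indic F : measurable F -> \int[P]_w \1_F w = Pr F.
Proof. by move=> mF; rewrite /Rintegral integral_indic// setIT. Qed.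

Lemma fine_probM (E F G : set Om) : measurable E -> measurable F ->
  P G = (P E * P F)%E -> Pr G = Pr E * Pr F.
Proof. by move=> mE mF ->; rewrite fineM// fin_num_measure. Qed.

Lemma fine_prob_ge0 (F : set Om) : 0 <= Pr F. Proof. exact: fine_ge0. Qed.

Lemma fine_prob_le1 (F : set Om) : measurable F -> Pr F <= 1.
Proof.
move=> mF; rewrite -lee_fin fineK ?fin_num_measure//; exact: probability_le1.
Qed.

Lemma bounded_measurable_count (t : R) (k : nat) : bm (fun w => (N t w ==
  k)%:R).
Proof. by apply: bounded_measurable_bool; exact: measurable_fun_eqn. Qed.

Lemma bounded_measurable_increment (s t : R) (k : nat) : bm (fun w => ((N t w -
  N s w)%N == k)%:R).
Proof.
apply: bounded_measurable_bool; apply: measurable_fun_eqn => //.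
exact: measurable_fun_subn.
Qed.

Lemma bounded_measurable_increment_ge2 (s t : R) : bm (fun w => (2 <= N t w - N
  s w)%N%:R).
Proof.
apply: bounded_measurable_bool; apply: measurable_fun_leq => //.
exact: measurable_fun_subn.
Qed.

Lemma bounded_measurable_le (X : {RV P >-> R}) (b : R) : bm (fun w => (X w <=
  b)%R%:R).
Proof. by apply: bounded_measurable_bool; exact: measurable_fun_ler. Qed.

Lemma bounded_measurable_comp (X : {RV P >-> R}) (h : R -> R) :
  bounded_measurable setT h ->
  bm (fun w => h (X w)).
Proof.
move=> [mh [K hK]]; split; first exact: measurableT_comp.
by exists K => w _; exact: hK.
Qed.

Lemma future_bounded_measurable m t F : future N Z m t F -> bm (\1_F).
Proof.
by move=> FF; apply: bounded_measurable_indic; exact: future_measurable FF.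
Qed.

Lemma counts_mono_ae : {ae P, forall w, forall s t, 0 <= s -> s <= t ->
  (N s w <= N t w)%N}.
Proof.
apply: filterS (counts N_poisson) => w H s t s0 st.
have t0 := le_trans s0 st.
case E : (N s w) => [//|k]; rewrite H//; apply: le_trans st.
by rewrite -H// E.
Qed.

Lemma jump_times_gt0_ae : {ae P, forall w, forall k, (1 <= k)%N -> 0 < T k w}.
Proof.
apply: filterS (jump_times_increasing N_poisson) => w [T1 Ti] [//|k] _.
by elim: k => [//|k ih]; apply: lt_trans ih (Ti _ _).
Qed.

Lemma count0_ae : {ae P, forall w, N 0 w = 0%N}.
Proof.
apply: filterS2 (counts N_poisson) jump_times_gt0_ae => w H T0.
apply/eqP; rewrite -leqn0 leqNgt; apply/negP; rewrite H//.
by rewrite leNgt T0.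
Qed.

Lemma indic_increment s t k (w : Om) :
  \1_[set w | (N t w - N s w)%N = k] w = ((N t w - N s w)%N == k)%:R :> R.
Proof.
by rewrite indicE; case: eqP => h; [rewrite mem_set|rewrite memNset].
Qed.

(** With x = lambda (t - s) the left-hand side is 1 - (1 + x) e^(-x). *)
Lemma increment_ge2_prob s t : 0 <= s -> s <= t ->
  \int[P]_w (2 <= N t w - N s w)%N%:R <= (lambda * (t - s)) ^+ 2.
Proof.
move=> s0 st; have b0 := bounded_measurable_increment s t 0;
  have b1 := bounded_measurable_increment s t 1.
have e k : \int[P]_w (((N t w - N s w)%N == k)%:R : R) = poisson_weight (lambda
  * (t - s)) k.
  have <- : Pr [set w | (N t w - N s w)%N = k] = poisson_weight (lambda * (t -
    s)) k.
    by rewrite (increment_prob N_poisson).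
  rewrite -Rintegral_indic; last exact: (measurable_increment N s t [set k]).
  by apply: eq_Rintegral => w _; rewrite indic_increment.
have -> : \int[P]_w ((2 <= N t w - N s w)%N%:R : R) =
    \int[P]_w (1 - ((N t w - N s w)%N == 0%N)%:R - ((N t w - N s w)%N ==
      1%N)%:R).
  apply: eq_Rintegral => w _; case: (N t w - N s w)%N => [|[|k]] /=;
    by rewrite ?subr0 ?subrr.
have I1 : P.-integrable setT (EFin \o (fun=> 1 : R)).
  by apply: bounded_measurable_integrable_prob; exact: bounded_measurable_cst.
rewrite RintegralB//; [|apply: integrable_realB => //|];
  try exact: bounded_measurable_integrable_prob.
rewrite RintegralB//; try exact: bounded_measurable_integrable_prob.
rewrite Rintegral_cst//= probability_setT mul1r !e /poisson_weight.
rewrite expr0 fact0 expr1 divr1 divr1 mul1r.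
set x := lambda * (t - s).
have x0 : 0 <= x by rewrite mulr_ge0 ?subr_ge0// ltW.
have := expR_sub_bound x0; rewrite ler_norml => /andP[+ _].
rewrite mulrDl mul1r -[fine 1%E]/(1 : R); lra.
Qed.

(* Decompose the event that the jump following the [m] jumps that determine [V]
   occurs before [b] according to the small interval containing it. *)
Lemma jump_before_expectation (m : nat) (V : Om -> R) (a : R -> R) (t L : R) :
  bm V ->
  (forall s F, future N Z m s F ->
    \int[P]_w ((N s w == m)%:R * V w * \1_F w) = expR (- (lambda * s)) * a s *
      Pr F) ->
  bounded_measurable `[0, t] a ->
  (forall r s, 0 <= r -> r <= s -> s <= t -> `|a s - a r| <= L * (s - r)) ->
  forall b F, 0 <= b -> b <= t -> future N Z m t F ->
  \int[P]_w ((N b w == m.+1)%:R * ((N t w - N b w)%N == 0%N)%:R * V w * \1_F w)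
    =
  expR (- (lambda * t)) * lambda * primitive a b * Pr F.
Proof.
move=> bV HV ba aL b F b0 bt FF; have t0 := le_trans b0 bt.
have mF := future_measurable FF; have bF := future_bounded_measurable FF.
have [mV [K VK]] := bV.
have K0 : 0 <= K.
  have [w _] : [set: Om] !=set0.
    by apply/set0P/eqP => S0; have := probability_setT P;
      rewrite S0 measure0 => /eqP; rewrite eq_sym onee_eq0.
  exact: le_trans (VK w I).
pose X b w := (N b w == m.+1)%:R * ((N t w - N b w)%N == 0%N)%:R * V w * \1_F w
  : R.
have bX b' : bm (X b').
  by do 3 (apply: bounded_measurableM => //);
    [exact: bounded_measurable_count|exact: bounded_measurable_increment].
pose D b := \int[P]_w X b w - expR (- (lambda * t)) * lambda * primitive a b *
  Pr F.
have D0 : D 0 = 0.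
  rewrite /D primitive0 mulr0 mul0r subr0.
  rewrite (@ae_eq_Rintegral _ _ _ _ P measurableT _ (fun=> 0)) ?Rintegral_cst
    ?mul0r//.
    by have [] := bX 0.
  by apply: filterS count0_ae => w N0 _; rewrite /X N0/= !mul0r.
suff : D b = D 0 by rewrite D0 /D => /eqP; rewrite subr_eq0 => /eqP.
(* [K * lambda ^+ 2] pays for two jumps in ]r, s], and [lambda * L] for replacing [a] by [a r] on
   the cell. *)
apply: (@quadratic_increments_eq _ D b (K * lambda ^+ 2 + lambda * L)) => // r
  s r0 rs sb.
have s0 := le_trans r0 rs; have st := le_trans sb bt; have rt := le_trans rs st.
pose E1 := [set w | (N s w - N r w)%N = 1%N].
pose E0 := [set w | (N t w - N s w)%N = 0%N].
have [FF0 P0] := future_increment N_poisson Z_iid ZN_indep 0 s0 st FF.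
have [FF1 P1] := future_increment N_poisson Z_iid ZN_indep 1 r0 rs FF0.
(* One jump in ]r, s], none in ]s, t], and [F]: an event of the future of [r], to which [HV]
   applies. The exponentials over [0, r], ]r, s] and ]s, t] then combine into e^(-lambda t). *)
pose F' := E1 `&` (E0 `&` F).
have mE1 : measurable E1 := measurable_increment N r s [set 1%N].
have mE0 : measurable E0 := measurable_increment N s t [set 0%N].
pose Y w := (N r w == m)%:R * V w * \1_F' w : R.
have bY : bm Y.
  apply: bounded_measurableM; last exact: future_bounded_measurable FF1.
  by apply: bounded_measurableM => //; exact: bounded_measurable_count.
(* Almost surely this remainder vanishes unless ]r, s] contains two jumps, by
   [one_jump_indicator]. *)
pose Er w := X s w - X r w - Y w.
have bneg (W : Om -> R) : bm W -> bm (fun w => - W w).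
  move=> bW; apply: (bounded_measurable_eq (f := fun w => -1 * W w)).
    by move=> w _; rewrite mulN1r.
  by apply: bounded_measurableM => //; exact: bounded_measurable_cst.
have bEr : bm Er.
  by do 2 (apply: bounded_measurableD; last exact: bneg).
have eq1 : \int[P]_w X s w - \int[P]_w X r w - \int[P]_w Y w = \int[P]_w Er w.
  rewrite /Er RintegralB//; try exact: bounded_measurable_integrable_prob.
    by rewrite RintegralB//; exact: bounded_measurable_integrable_prob.
  by apply: integrable_realB => //; exact: bounded_measurable_integrable_prob.
have eqY : \int[P]_w Y w = expR (- (lambda * t)) * lambda * (s - r) * a r * Pr
  F.
  rewrite (HV _ _ FF1) (fine_probM mE1 (measurableI _ _ mE0 mF) P1) (fine_probM
    mE0 mF P0).
  rewrite (increment_prob N_poisson)// (increment_prob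
    N_poisson)//= /poisson_weight.
  rewrite expr0 expr1 fact0 !divr1 mul1r.
  have -> : lambda * t = lambda * r + lambda * (s - r) + lambda * (t - s) by
    ring.
  by rewrite !opprD !expRD; ring.
have ErK : `|\int[P]_w Er w| <= K * (lambda * (s - r)) ^+ 2.
  apply: le_trans (le_normr_Rintegral _ (bounded_measurable_integrable_prob
    bEr)) _ => //.
  apply: (@le_trans _ _ (\int[P]_w (K * (2 <= N s w - N r w)%N%:R)));
    last first.
    rewrite RintegralZl//; last by apply: bounded_measurable_integrable_prob;
      exact: bounded_measurable_increment_ge2.
    by rewrite ler_wpM2l// increment_ge2_prob.
  apply: ae_le_Rintegral => //.
  - exact: integrable_norm (bounded_measurable_integrable_prob bEr).
  - apply: bounded_measurable_integrable_prob; apply: bounded_measurableM.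
      exact: bounded_measurable_cst.
    exact: bounded_measurable_increment_ge2.
  apply: filterS counts_mono_ae => w mono _.
  have Nrs := mono _ _ r0 rs; have Nst := mono _ _ s0 st.
  have Fw : \1_F' w = (((N s w - N r w)%N == 1%N) && ((N t w - N s w)%N ==
    0%N))%:R * \1_F w :> R.
    by rewrite /F' !indicI /= !indic_increment mulrA -natrM mulnb.
  have F1 : `|\1_F w| <= 1 :> R.
    by rewrite indicE; case: (_ \in _); rewrite ?normr1 ?normr0.
  have -> : Er w = ((N s w == m.+1)%:R * ((N t w - N s w)%N == 0%N)%:R
      - (N r w == m.+1)%:R * ((N t w - N r w)%N == 0%N)%:R
      - (N r w == m)%:R * (((N s w - N r w)%N == 1%N) && ((N t w - N s w)%N ==
          0%N))%:R)
      * (V w * \1_F w).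
    by rewrite /Er /X /Y Fw; ring.
  rewrite normrM mulrC; apply: ler_pM => //.
    by rewrite normrM -[leRHS]mulr1; apply: ler_pM => //; exact: VK.
  exact: one_jump_indicator.
have Dd : D s - D r = \int[P]_w Er w -
    expR (- (lambda * t)) * lambda * Pr F * \int[mu]_(x in `]r, s]) (a x - a r).
  have st' := le_trans sb bt.
  have Ia := bounded_measurable_integrable_itv ba.
  have Irs : mu.-integrable `]r, s] (EFin \o (fun=> a r)).
    by apply: bounded_measurable_integrable => //;
      [exact: lebesgue_itv_lty|exact: bounded_measurable_cst].
  rewrite RintegralB//; last exact: integrable_itvS_oc Ia.
  rewrite -(primitiveB r0 rs st Ia) Rintegral_cst//= lebesgue_measure_itv/=
    lte_fin.
  have -> : fine (if r < s then (s%:E - r%:E)%E else 0%E) = s - r.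
    by case: ltgtP rs => //= -> _; rewrite subrr.
  by rewrite -eq1 eqY /D; ring.
rewrite Dd; apply: le_trans (ler_normB _ _) _; rewrite [leRHS]mulrDl;
  apply: lerD.
  by apply: le_trans ErK _; rewrite exprMn mulrA.
have e1 : `|\int[mu]_(x in `]r, s]) (a x - a r)| <= L * (s - r) * (s - r).
  have Ia := bounded_measurable_integrable_itv ba.
  apply: Rintegral_oc_bound => //.
    apply: integrable_realB => //; first exact: integrable_itvS_oc Ia.
    by apply: bounded_measurable_integrable => //;
      [exact: lebesgue_itv_lty|exact: bounded_measurable_cst].
  move=> x rx xs; apply: le_trans (aL r x r0 (ltW rx) (le_trans xs st)) _.
  apply: ler_wpM2l; last by rewrite lerB.
  have := aL r x r0 (ltW rx) (le_trans xs st).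
  by move=> /(le_trans (normr_ge0 _)); rewrite pmulr_lge0// subr_gt0.
have e0 : expR (- (lambda * t)) <= 1.
  by rewrite -expR0 ler_expR oppr_le0 mulr_ge0// ltW.
have h : expR (- (lambda * t)) * lambda * Pr F <= lambda.
  rewrite mulrAC -[leRHS]mul1r ler_wpM2r ?(ltW lambda_gt0)//.
  by rewrite mulr_ile1 ?expR_ge0 ?fine_prob_ge0 ?fine_prob_le1.
have h0 : 0 <= expR (- (lambda * t)) * lambda * Pr F.
  by rewrite !mulr_ge0 ?expR_ge0 ?fine_prob_ge0// ltW.
rewrite normrM ger0_norm// expr2 -[leRHS]mulrA (mulrA L).
exact: ler_pM.
Qed.

End jump_expectation.

(** * The effect of one more jump and of its mark *)

Section collapse_moments.
Context (R : realType) (d : measure_display) (Om : measurableType d)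
  (P : probability Om R) (lambda : R)
  (N : R -> {RV P >-> nat}) (T Z : nat -> {RV P >-> R}).
Hypothesis lambda_gt0 : 0 < lambda.
Hypothesis (N_poisson : poisson_process lambda N T).
Hypothesis (Z_iid : iid_uniform01 Z).
Hypothesis (ZN_indep : independent_sigma P
      (sigma_of_family [set k | (1 <= k)%N] (fun k => Z k : Om -> R))
      (sigma_of_family [set s : R | 0 <= s] (fun s : R => N s : Om -> nat))).

Local Notation mu := (@lebesgue_measure R).
Local Notation bm := (@bounded_measurable _ Om R setT).
Local Notation Pr F := (fine (P F)).

Lemma indic_le (U : Type) (X : U -> R) (b : R) (w : U) :
  \1_(X @^-1` `]-oo, b]) w = (X w <= b)%R%:R :> R.
Proof.
rewrite indicE; case: (boolP (X w <= b)) => Xb;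
  [rewrite mem_set|rewrite memNset] => //.
by rewrite /= in_itv/=; exact/negP.
Qed.

Section one_jump.
Variables (m : nat) (V : Om -> R) (a : R -> R) (t L : R).
Hypothesis bV : bm V.
Hypothesis HV : forall s F, future N Z m s F ->
    \int[P]_w ((N s w == m)%:R * V w * \1_F w) = expR (- (lambda * s)) * a s *
      Pr F.
Hypothesis ba : bounded_measurable `[0, t] a.
Hypothesis aL : forall r s, 0 <= r -> r <= s -> s <= t ->
  `|a s - a r| <= L * (s - r).
Hypothesis t0 : 0 <= t.

(** For 0 <= b <= t, having N_t = m + 1 and T_(m+1) <= b means, almost surely, m + 1 jumps before
    [b] and none in ]b, t]. [jump_before_expectation] is therefore the distribution function of
    T_(m+1) under the weight [W1], and [Borel_extension] passes to [h]. *)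
Lemma jump_time_expectation (h : R -> R) F : bounded_measurable setT h ->
  future N Z m t F ->
  \int[P]_w ((N t w == m.+1)%:R * V w * \1_F w * h (T m.+1 w)) =
  expR (- (lambda * t)) * lambda * primitive (fun s => h s * a s) t * Pr F.
Proof.
move=> bh FF; pose c := expR (- (lambda * t)) * lambda * Pr F.
have bF : bm \1_F := future_bounded_measurable FF.
pose W1 w := (N t w == m.+1)%:R * V w * \1_F w : R.
have bW1 : bm W1.
  by do 2 (apply: bounded_measurableM => //); exact: bounded_measurable_count.
pose W2 s := c * (a \_ `[0, t]) s.
have Ia u : mu.-integrable `[0, t] (EFin \o u) ->
    mu.-integrable setT (EFin \o (u \_ `[0, t])).
  move=> Iu; rewrite -restrict_EFin; apply/integrable_restrict => //.
  by rewrite setTI.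
have IW2 : mu.-integrable setT (EFin \o W2).
  apply: integrable_bounded_mull => //; last exact: bounded_measurable_cst.
  by apply: Ia; exact: bounded_measurable_integrable_itv.
have before b : 0 <= b -> b <= t -> \int[P]_w ((N b w == m.+1)%:R *
    ((N t w - N b w)%N == 0%N)%:R * V w * \1_F w) = c * primitive a b.
  move=> b0 bt.
  rewrite (jump_before_expectation lambda_gt0 N_poisson Z_iid ZN_indep bV HV ba
    aL b0 bt FF).
  by rewrite /c; ring.
have IntW2 u b : 0 <= b -> mu.-integrable `[0, b] (EFin \o u) ->
    \int[mu]_s (c * (u \_ `[0, b]) s) = c * primitive u b.
  move=> b0 Iu; rewrite RintegralZl//; first by rewrite /primitive [in
    RHS]Rintegral_mkcond.
  rewrite -restrict_EFin; apply/integrable_restrict => //; by rewrite setTI.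
have total : \int[P]_w W1 w = \int[mu]_s W2 s.
  rewrite IntW2//; last exact: bounded_measurable_integrable_itv.
  rewrite -before//; apply: eq_Rintegral => w _; rewrite subnn eqxx mulr1.
  by rewrite /W1.
have mT : measurable_fun setT (T m.+1 : Om -> R) by [].
have Iah : mu.-integrable `[0, t] (EFin \o (fun s => h s * a s)).
  apply: bounded_measurable_integrable_itv; apply: bounded_measurableM => //.
  by apply: bounded_measurableS bh.
transitivity (\int[mu]_s (W2 s * h (idfun s))); last first.
  transitivity (\int[mu]_s (c * ((fun s => h s * a s) \_ `[0, t]) s)).
    apply: eq_Rintegral => s _; rewrite /W2 !patchE /idfun /=.
    by case: ifP => _; rewrite ?mulr0 ?mul0r//; ring.
  by rewrite IntW2// /c; ring.
apply: (@Borel_extension _ _ _ (measurableTypeR R) R P mu W1 W2 (T m.+1) idfun)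
  => //.
- exact: bounded_measurable_integrable_prob.
- exact: measurable_id.
move=> b; have bWb : bm (fun w => W1 w * (T m.+1 w <= b)%R%:R).
  by apply: bounded_measurableM => //; exact: bounded_measurable_le.
(* Outside [0, t] the condition is trivial: jump times are positive, and N_t = m + 1 forces T_(m+1)
   <= t. *)
have [b0|b0] := ltP b 0.
  rewrite (@ae_eq_Rintegral _ _ _ _ P measurableT _ (fun=> 0)) //; last first.
  - apply: filterS (jump_times_gt0_ae N_poisson) => w T0 _.
    by rewrite leNgt (lt_trans b0 (T0 _ _))// mulr0.
  - by have [] := bWb.
  rewrite Rintegral_cst// mul0r (@eq_Rintegral _ _ _ _ _ (fun=> 0)).
    by rewrite Rintegral_cst// mul0r.
  move=> s _; rewrite /W2 patchE mem_setE in_itv/=.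
  case: (leP 0 s) => s0 /=; last by rewrite mulr0 mul0r.
  by rewrite (lt_geF (lt_le_trans b0 s0)) mulr0.
have [bt|tb] := leP b t.
  rewrite (@ae_eq_Rintegral _ _ _ _ P measurableT _ (fun w => (N b w ==
    m.+1)%:R *
    ((N t w - N b w)%N == 0%N)%:R * V w * \1_F w)).
  - rewrite before// -IntW2//; last first.
      by apply: integrable_itvS bt _; exact: bounded_measurable_integrable_itv.
    apply: eq_Rintegral => s _; rewrite /W2 !patchE !mem_setE !in_itv/=.
    case: (leP 0 s) => s0 /=; last by rewrite mulr0 mul0r.
    case: (leP s b) => sb /=; last by rewrite !mulr0.
    by rewrite (le_trans sb bt) mulr1.
  - by have [] := bWb.
  - have [//] : bm (fun w => (N b w == m.+1)%:R *
      ((N t w - N b w)%N == 0%N)%:R * V w * \1_F w).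
    by do 3 (apply: bounded_measurableM => //);
      [exact: bounded_measurable_count|exact: bounded_measurable_increment].
  apply: filterS2 (counts N_poisson) (counts_mono_ae N_poisson) => w cnt mono _.
  have := mono b t b0 bt; rewrite /W1 -cnt// => bt'.
  suff : (N t w == m.+1) && (m.+1 <= N b w)%N = (N b w == m.+1) && ((N t w - N
    b w)%N == 0%N).
    move=> e; have e' : (N t w == m.+1)%:R * (m.+1 <= N b w)%N%:R =
        (N b w == m.+1)%:R * ((N t w - N b w)%N == 0%N)%:R :> R.
      by rewrite -!natrM !mulnb e.
    rewrite -e'; ring.
  by apply/idP/idP; lia.
rewrite (@ae_eq_Rintegral _ _ _ _ P measurableT _ W1) //.
- rewrite total; apply: eq_Rintegral => s _;
    rewrite /W2 patchE mem_setE in_itv/=.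
  case: ifP => [/andP[_ st]|_]; last by rewrite mulr0 mul0r.
  by rewrite (le_trans st (ltW tb)) mulr1.
- by have [] := bWb.
- by have [] := bW1.
apply: filterS (counts N_poisson) => w cnt _; rewrite /W1.
case: (eqVneq (N t w) m.+1) => [e|]; last by rewrite !mul0r.
have : (m.+1 <= N t w)%N by rewrite e.
by rewrite cnt// => Tt; rewrite (le_trans Tt (ltW tb)) mulr1.
Qed.

(** As [F] involves only marks after the (m+1)-st, intersecting it with the event Z_(m+1) <= b gives
    an event of the future again and multiplies its probability. This settles the indicators of
    half-lines, and [Borel_extension] replaces them by [zeta]. *)
Lemma jump_time_mark_expectation (h zeta : R -> R) F : bounded_measurable setT
  h ->
  bounded_measurable setT zeta -> future N Z m.+1 t F ->
  \int[P]_w ((N t w == m.+1)%:R * V w * \1_F w * h (T m.+1 w) * zeta (Z m.+1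
    w)) =
  expR (- (lambda * t)) * lambda * primitive (fun s => h s * a s) t * Pr F *
  \int[P]_w zeta (Z m.+1 w).
Proof.
move=> bh bzeta FF; have mF := future_measurable FF.
pose c := expR (- (lambda * t)) * lambda * primitive (fun s => h s * a s) t *
  Pr F.
have bF : bm \1_F := future_bounded_measurable FF.
have bW : bm (fun w => (N t w == m.+1)%:R * V w * \1_F w * h (T m.+1 w)).
  apply: bounded_measurableM; last exact: bounded_measurable_comp.
  by do 2 (apply: bounded_measurableM => //); exact: bounded_measurable_count.
rewrite -/c -RintegralZl//; last by apply: bounded_measurable_integrable_prob;
  exact: bounded_measurable_comp.
have ET := jump_time_expectation bh (futureS FF).
apply: (@Borel_extension _ Om _ Om R P P
  (fun w => (N t w == m.+1)%:R * V w * \1_F w * h (T m.+1 w)) (fun=> c)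
  (Z m.+1) (Z m.+1)) => //.
- exact: bounded_measurable_integrable_prob.
- by apply: bounded_measurable_integrable_prob; exact: bounded_measurable_cst.
- by rewrite ET Rintegral_cst//= probability_setT /= mulr1.
move=> b; pose E := (Z m.+1 : Om -> R) @^-1` `]-oo, b].
have mE : measurable E by rewrite /E -[X in measurable X]setTI;
  exact: measurable_funP.
have Eb w : \1_E w = (Z m.+1 w <= b)%R%:R :> R by exact: indic_le.
have [FE PE] := future_mark N_poisson Z_iid ZN_indep (measurable_itv `]-oo, b])
  FF.
have := jump_time_expectation bh FE; rewrite (fine_probM mE mF PE).
rewrite RintegralZl//; last by apply: bounded_measurable_integrable_prob;
  exact: bounded_measurable_le.
have -> : \int[P]_w ((Z m.+1 w <= b)%R%:R) = Pr E.
  by rewrite -Rintegral_indic//; apply: eq_Rintegral => w _; rewrite Eb.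
have -> : c * Pr E = expR (- (lambda * t)) * lambda *
  primitive (fun s => h s * a s) t * (Pr E * Pr F) by rewrite /c; ring.
by move=> <-; apply: eq_Rintegral => w _; rewrite indicI /= Eb; ring.
Qed.

End one_jump.

(** The marks lie in [0, 1] only almost surely; clamping makes the bounds hold at every point of the
    sample space. *)
Definition clamp01 (z : R) : R := Num.min 1 (Num.max 0 z).

Lemma clamp01_itv z : 0 <= clamp01 z <= 1.
Proof. by rewrite /clamp01 le_min ler01 le_max lexx ge_min lexx. Qed.

Lemma clamp01_id z : 0 <= z -> z <= 1 -> clamp01 z = z.
Proof. by move=> z0 z1; rewrite /clamp01 max_r// min_r. Qed.

Lemma bounded_measurable_clamp01 : bounded_measurable setT clamp01.
Proof.
split; first by apply: measurable_minr => //; exact: measurable_maxr.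
by exists 1 => z _; have /andP[z0 z1] := clamp01_itv z; rewrite ger0_norm.
Qed.

Definition clamp01_monomial (n j : nat) (z : R) : R :=
  clamp01 z ^+ j * (1 - clamp01 z) ^+ (n - j).

Lemma bounded_measurable_clamp01_monomial n j :
  bounded_measurable setT (clamp01_monomial n j).
Proof.
apply: bounded_measurableM; apply: bounded_measurableX.
  exact: bounded_measurable_clamp01.
apply: (bounded_measurable_eq (f := fun z => 1 + -1 * clamp01 z)).
  by move=> z _; rewrite mulN1r.
apply: bounded_measurableD; first exact: bounded_measurable_cst.
apply: bounded_measurableM; first exact: bounded_measurable_cst.
exact: bounded_measurable_clamp01.
Qed.

(** The law of the mark turns the expectation into the Beta integral B(j+1, n-j+1) = j!
    (n-j)!/(n+1)!. *)
Lemma mark_monomial_expectation k n j : (1 <= k)%N -> (j <= n)%N ->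
  \int[P]_w clamp01_monomial n j (Z k w) = ('C(n, j) * n.+1)%:R^-1.
Proof.
move=> k1 jn; have [mz _] := bounded_measurable_clamp01_monomial n j.
have z0 z : 0 <= clamp01_monomial n j z.
  have /andP[h0 h1] := clamp01_itv z.
  by rewrite mulr_ge0// exprn_ge0// subr_ge0.
have -> : \int[P]_w clamp01_monomial n j (Z k w) = beta_fun j.+1 (n - j).+1.
  have b1 : bounded_measurable [set: Om] (fun=> 1 : R) by exact:
    bounded_measurable_cst.
  have I2 : (uniform_prob (@ltr01 R)).-integrable setT (EFin \o (fun=> 1 : R)).
    apply: (@bounded_measurable_integrable_prob R _ (measurableTypeR R)).
    exact: bounded_measurable_cst.
  have mid : measurable_fun [set: measurableTypeR R] (idfun : measurableTypeR R
    -> R).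
    exact: measurable_id.
  have mZ : measurable_fun setT (Z k : Om -> R) by [].
  have bE : \int[P]_w (1 * clamp01_monomial n j (Z k w)) =
      \int[uniform_prob (@ltr01 R)]_z (1 * clamp01_monomial n j (idfun z)).
    apply: (Borel_extension (bounded_measurable_integrable_prob P b1) I2 mZ
      mid); last first.
    - exact: bounded_measurable_clamp01_monomial.
    - move=> b; under eq_Rintegral do rewrite mul1r.
      under [RHS]eq_Rintegral do rewrite mul1r.
      have mE : measurable ((Z k : Om -> R) @^-1` `]-oo, b]).
        by rewrite -[X in measurable X]setTI; exact: measurable_funP.
      transitivity (Pr ((Z k : Om -> R) @^-1` `]-oo, b])).
        rewrite -Rintegral_indic//; apply: eq_Rintegral => w _.
        exact/esym/indic_le.
      have -> : P ((Z k : Om -> R) @^-1` `]-oo, b]) = uniform_prob (@ltr01 R)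
        `]-oo, b].
        exact: Z_iid.2.
      rewrite -(@Rintegral_indic _ _ (measurableTypeR R)) //;
        apply: eq_Rintegral => z _.
      exact: (indic_le (idfun : measurableTypeR R -> R)).
    by rewrite !Rintegral_cst//= !probability_setT.
  under eq_Rintegral do rewrite -[clamp01_monomial _ _ _]mul1r.
  rewrite bE.
  rewrite /Rintegral /beta_fun /Rintegral; congr fine.
    under eq_integral do rewrite mul1r.
    rewrite integral_uniform; last 2 first.
    + by apply/measurable_EFinP.
    + by move=> z; rewrite lee_fin.
    rewrite subr0 invr1 mul1e [LHS]integral_mkcond; apply: eq_integral => z _.
    rewrite !patchE mem_setE in_itv/=; case: ifP => //= /andP[h0 h1].
    by rewrite /clamp01_monomial clamp01_id.
rewrite beta_fun_fact subnKC// factS -(bin_fact jn).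
have p (i : nat) : (i`!%:R : R) != 0 by rewrite pnatr_eq0 -lt0n fact_gt0.
have q : ('C(n, j)%:R : R) != 0 by rewrite pnatr_eq0 -lt0n bin_gt0.
have r : (n.+1%:R : R) != 0 by rewrite pnatr_eq0.
rewrite !natrM; field; by rewrite !p q addrC -natr1 in r *; rewrite r.
Qed.

End collapse_moments.

(** * Moments for bounded functions *)

Fixpoint collapse (R : realDomainType) (g : R -> R) (tau z : nat -> R) (m :
  nat) : R :=
  if m is m'.+1 then
    z m * collapse g tau z m' + (1 - z m) * g (tau m)
  else 0.

Lemma collapseE (R : realDomainType) (g : R -> R) (tau z : nat -> R) (m : nat) :
  collapse g tau z m = \sum_(1 <= k < m.+1)
    g (tau k) * (1 - z k) * \prod_(k.+1 <= l < m.+1) z l.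
Proof.
elim: m => [|m ih] /=; first by rewrite big_geq.
rewrite [RHS]big_nat_recr//=; congr (_ + _); last first.
  by rewrite [in RHS]big_geq// mulr1 mulrC.
rewrite ih mulr_sumr; apply: eq_big_nat => k /andP[_ km].
by rewrite [in RHS]big_nat_recr//= mulrC mulrA.
Qed.

(** Every jump forms a convex combination, so domination is preserved step by step. *)
Lemma collapse_le (R : realDomainType) (g1 g2 : R -> R) (tau z : nat -> R) m :
  (forall k, (1 <= k)%N -> 0 <= z k <= 1) ->
  (forall k, (1 <= k)%N -> `|g1 (tau k)| <= g2 (tau k)) ->
  `|collapse g1 tau z m| <= collapse g2 tau z m.
Proof.
move=> z01 g12; elim: m => [|m ih] /=; first by rewrite normr0.
have /andP[z0 z1] := z01 m.+1 isT.
have z1' : 0 <= 1 - z m.+1 by rewrite subr_ge0.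
apply: le_trans (ler_normD _ _) _; rewrite !normrM (ger0_norm z0) (ger0_norm
  z1').
by apply: lerD; apply: ler_wpM2l => //; exact: g12.
Qed.

Lemma collapse_cst_le (R : realDomainType) (K : R) (tau z : nat -> R) m :
  0 <= K -> (forall k, (1 <= k)%N -> 0 <= z k <= 1) ->
  collapse (fun=> K) tau z m <= K.
Proof.
move=> K0 z01; elim: m => [//|m ih] /=.
have /andP[z0 z1] := z01 m.+1 isT.
apply: (@le_trans _ _ (z m.+1 * K + (1 - z m.+1) * K)).
  by rewrite lerD2r ler_wpM2l.
by rewrite -mulrDl subrKC mul1r.
Qed.

Section bounded_moments.
Context (R : realType) (d : measure_display) (Om : measurableType d)
  (P : probability Om R) (lambda : R)
  (N : R -> {RV P >-> nat}) (T Z : nat -> {RV P >-> R}).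
Hypothesis lambda_gt0 : 0 < lambda.
Hypothesis (N_poisson : poisson_process lambda N T).
Hypothesis (Z_iid : iid_uniform01 Z).
Hypothesis (ZN_indep : independent_sigma P
      (sigma_of_family [set k | (1 <= k)%N] (fun k => Z k : Om -> R))
      (sigma_of_family [set s : R | 0 <= s] (fun s : R => N s : Om -> nat))).

Local Notation mu := (@lebesgue_measure R).
Local Notation bm := (@bounded_measurable _ Om R setT).
Local Notation Pr F := (fine (P F)).

Definition collapse_at (g : R -> R) (m : nat) (w : Om) : R :=
  collapse g (fun k => T k w) (fun k => clamp01 (Z k w)) m.

Lemma bounded_measurable_collapse_at g m : bounded_measurable setT g -> bm
  (collapse_at g m).
Proof.
move=> bg; elim: m => [|m ih]; first exact: bounded_measurable_cst.
have bZ := bounded_measurable_comp (Z m.+1) (@bounded_measurable_clamp01 R).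
apply: bounded_measurableD; first exact: bounded_measurableM.
apply: bounded_measurableM; last exact: bounded_measurable_comp.
apply: (bounded_measurable_eq (f := fun w => 1 + -1 * clamp01 (Z m.+1 w))).
  by move=> w _; rewrite mulN1r.
apply: bounded_measurableD; first exact: bounded_measurable_cst.
by apply: bounded_measurableM => //; exact: bounded_measurable_cst.
Qed.

Lemma measurable_collapse_count g t : measurable_fun setT g ->
  measurable_fun setT (fun w => collapse_at g (N t w) w).
Proof.
move=> mg; apply: (measurable_random_index (F := collapse_at g)) => //.
have mc k : measurable_fun setT (fun w => clamp01 (Z k w)).
  by apply: measurableT_comp => //; case: (bounded_measurable_clamp01 R).
elim=> [|m ih]; first exact: measurable_cst.
apply: measurable_funD; first exact: measurable_funM.
apply: measurable_funM; first exact: measurable_funB.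
exact: measurableT_comp.
Qed.

Section bounded_marks.
Variable g : R -> R.
Hypothesis bg : bounded_measurable setT g.

(** Induction on [m], for all powers, times and events at once: the moment of order [n] after m + 1
    jumps uses all orders j <= n after [m] jumps, at earlier times and with larger constraints on
    the future. *)
Lemma collapse_moment m n t F : future N Z m t F ->
  \int[P]_w ((N t w == m)%:R * collapse_at g m w ^+ n * \1_F w) =
  expR (- (lambda * t)) * (lambda ^+ m * jump_moment g m n t) * Pr F.
Proof.
elim: m n t F => [|m ih] n t F FF.
  have mF := future_measurable FF; have bF : bm \1_F :=
    future_bounded_measurable FF.
  have t0 : 0 <= t by case: FF => [u [J [A [K [B [[t0 _ _] _]]]]]].
  have [FE PE] := future_increment N_poisson Z_iid ZN_indep 0 (lexx 0) t0 FF.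
  have mE : measurable [set w | (N t w - N 0 w)%N = 0%N] :=
    measurable_increment N 0 t [set 0%N].
  (* As N_0 = 0 almost surely, the absence of jumps is a zero increment over [0, t]; the value
     before the first jump is 0, and its power is 1 only for n = 0. *)
  transitivity (\int[P]_w ((n == 0)%:R *
      \1_([set w | (N t w - N 0 w)%N = 0%N] `&` F) w)).
    apply: ae_eq_Rintegral => //.
    - have [//] : bm (fun w => (N t w == 0%N)%:R * collapse_at g 0 w ^+ n *
        \1_F w).
      apply: bounded_measurableM => //; apply: bounded_measurableM.
        exact: bounded_measurable_count.
      by apply: bounded_measurableX; exact: bounded_measurable_collapse_at.
    - by apply: measurable_funM => //; apply: measurable_indic;
        exact: measurableI.
    apply: filterS (count0_ae N_poisson) => w N0 _.
    by rewrite indicI /= indic_increment N0 subn0 /collapse_at /= expr0n; ring.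
  rewrite RintegralZl//; last by apply: bounded_measurable_integrable_prob;
    exact: future_bounded_measurable FE.
  rewrite Rintegral_indic; last exact: measurableI.
  rewrite (fine_probM mE mF PE) (increment_prob N_poisson)//= /poisson_weight
    subr0.
  by rewrite expr0 fact0 expr0 divr1; ring.
have t0 : 0 <= t by case: FF => [u [J [A [K [B [[t0 _ _] _]]]]]].
have bF : bm \1_F := future_bounded_measurable FF.
have bgX i : bounded_measurable setT (fun s => g s ^+ i) := bounded_measurableX
  i bg.
have bgt : bounded_measurable `[0, t] g by exact: bounded_measurableS bg.
(* The [j]-th binomial term without its coefficient; the mark is kept as a separate factor so that
   it can be integrated out. *)
pose Y j w := (N t w == m.+1)%:R * collapse_at g m w ^+ j * \1_F w *
  g (T m.+1 w) ^+ (n - j) * clamp01_monomial n j (Z m.+1 w).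
have bY j : bm (Y j).
  apply: bounded_measurableM; last first.
    by apply: bounded_measurable_comp; exact:
      bounded_measurable_clamp01_monomial.
  apply: bounded_measurableM; last exact: bounded_measurable_comp (bgX _).
  apply: bounded_measurableM => //; apply: bounded_measurableM;
    first exact: bounded_measurable_count.
  by apply: bounded_measurableX; exact: bounded_measurable_collapse_at.
transitivity (\int[P]_w (\sum_(j < n.+1) 'C(n, j)%:R * Y j w)).
  apply: eq_Rintegral => w _; rewrite /collapse_at /= -/(collapse_at g m w).
  rewrite addrC exprDn mulr_sumr mulr_suml; apply: eq_bigr => j _.
  rewrite /Y /clamp01_monomial !exprMn -mulr_natl; ring.
rewrite Rintegral_sum//; last first.
  move=> j _; apply: bounded_measurable_integrable_prob;
    apply: bounded_measurableM => //.
  exact: bounded_measurable_cst.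
rewrite /= mulr_sumr mulr_sumr mulr_sumr mulr_suml; apply: eq_bigr => j _.
rewrite RintegralZl//; last exact: bounded_measurable_integrable_prob.
have bJ := bounded_measurable_jump_moment bgt m j.
have [L hL] := jump_moment_lipschitz bgt m j.
(* The [j]-th power after [m] jumps plays the role of [V], and lambda^m J_(m,j) that of [a], by the
   induction hypothesis. *)
rewrite (@jump_time_mark_expectation _ _ _ _ _ _ _ _ lambda_gt0 N_poisson Z_iid
  ZN_indep m
  (fun w => collapse_at g m w ^+ j) (fun s => lambda ^+ m * jump_moment g m j
    s) t
  (lambda ^+ m * L) _ _ _ _ t0 (fun s => g s ^+ (n - j)) (clamp01_monomial n
    j)) //.
- rewrite mark_monomial_expectation// ?leq_ord//.
  have -> : primitive (fun s => g s ^+ (n - j) * (lambda ^+ m * jump_moment g m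
    j s)) t =
      lambda ^+ m * primitive (fun s => g s ^+ (n - j) * jump_moment g m j s) t.
    rewrite -primitiveZ; last first.
      apply: bounded_measurable_integrable_itv;
        apply: bounded_measurableM => //.
      exact: bounded_measurableX.
    by apply: eq_primitive => s _ _; ring.
  have q : ('C(n, j)%:R : R) != 0 by rewrite pnatr_eq0 -lt0n bin_gt0 -ltnS.
  have r : (n.+1%:R : R) != 0 by rewrite pnatr_eq0.
  rewrite natrM invfM exprS; move: (expR _) (primitive _ _) (n.+1%:R) r ('C(n,
    j)%:R) q => e p x r y q.
  by field; rewrite q r.
- by apply: bounded_measurableX; exact: bounded_measurable_collapse_at.
- by move=> s G FG; exact: ih.
- by apply: bounded_measurableM => //; exact: bounded_measurable_cst.
- move=> r s r0 rs st; rewrite -mulrBr normrM -mulrA ger0_norm ?exprn_ge0 ?(ltW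
    lambda_gt0)//.
  by rewrite ler_wpM2l ?exprn_ge0 ?(ltW lambda_gt0)// hL.
- exact: bounded_measurable_clamp01_monomial.
Qed.

Lemma collapse_bound : exists2 K, 0 <= K & forall m w, `|collapse_at g m w|
  <= K.
Proof.
have [_ [K hK]] := bg; have K0 : 0 <= K by apply: le_trans (hK 0 I).
exists K => // m w; apply: le_trans (collapse_cst_le (fun k => T k w)
  (z := fun k => clamp01 (Z k w)) m K0 _); last by move=> k _;
    exact: clamp01_itv.
by apply: collapse_le => k _; [exact: clamp01_itv|exact: hK].
Qed.

(** The functions [S] are the limits of the jump series, so [jump_series_chain_sum] evaluates them;
    multiplying by e^(-lambda t) turns e^(lambda t/(n+1)) into the stated prefactor. *)
Lemma bounded_collapse_moment n t : 0 <= t ->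
  \int[P]_w (collapse_at g (N t w) w ^+ n) =
  expR (- (n%:R * lambda * t / n.+1%:R)) * chain_sum lambda g n t.
Proof.
move=> t0; have [K K0 hK] := collapse_bound.
have bgt : bounded_measurable `[0, t] g by exact: bounded_measurableS bg.
pose S n s := expR (lambda * s) * \int[P]_w (collapse_at g (N s w) w ^+ n).
(* Adding the moments over m < p restricts the expectation to N_s < p. This gives bounds uniform in
   [p] and, by dominated convergence, the limit. *)
have partial p i s : 0 <= s ->
  \sum_(0 <= m < p) lambda ^+ m * jump_moment g m i s =
  expR (lambda * s) * \int[P]_w ((N s w < p)%N%:R * collapse_at g (N s w) w ^+
    i).
  move=> s0.
  transitivity (expR (lambda * s) * \sum_(0 <= m < p)
      \int[P]_w ((N s w == m)%:R * collapse_at g m w ^+ i)).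
    rewrite mulr_sumr; apply: eq_bigr => m _.
    have := collapse_moment i (futureT N Z m s0).
    rewrite probability_setT mulr1.
    have -> : \int[P]_w ((N s w == m)%:R * collapse_at g m w ^+ i * \1_setT w) =
        \int[P]_w ((N s w == m)%:R * collapse_at g m w ^+ i).
      by apply: eq_Rintegral => w _; rewrite indicT mulr1.
    by move=> ->; rewrite mulrA -expRD subrr expR0 mul1r.
  congr (_ * _); rewrite -Rintegral_sum//; last first.
    move=> m _; apply: bounded_measurable_integrable_prob;
      apply: bounded_measurableM.
      exact: bounded_measurable_count.
    by apply: bounded_measurableX; exact: bounded_measurable_collapse_at.
  apply: eq_Rintegral => w _; case: (ltnP (N s w) p) => Np.
    rewrite big_mkord (bigD1 (Ordinal Np))//= eqxx !mul1r big1 ?addr0// => j jN.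
    by rewrite (_ : (N s w == j) = false) ?mul0r//;
      apply: contra_neqF jN => /eqP jN; apply/val_inj.
  rewrite mul0r big_nat_cond big1// => m /andP[/andP[_ mp] _].
  by rewrite gtn_eqF ?mul0r//; exact: leq_trans Np.
have bC i s p : bm (fun w => (N s w < p)%N%:R * collapse_at g (N s w) w ^+ i).
  apply: bounded_measurableM.
    by apply: bounded_measurable_bool; exact: measurable_fun_ltn.
  apply: bounded_measurableX; split; first by apply: measurable_collapse_count;
    case: bg.
  by exists K => w _; exact: hK.
have bnd i s p w : `|(N s w < p)%N%:R * collapse_at g (N s w) w ^+ i| <= K ^+ i.
  rewrite normrM normrX -[leRHS]mul1r; apply: ler_pM => //.
    by rewrite ger0_norm// lern1; case: (_ < _)%N.
  by rewrite lerXn2r ?nnegrE.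
have cK i : P.-integrable setT (EFin \o (fun=> K ^+ i)).
  by apply: bounded_measurable_integrable_prob; exact: bounded_measurable_cst.
have HS : S n t = expR (lambda * t / n.+1%:R) * chain_sum lambda g n t.
  apply: (@jump_series_chain_sum _ _ lambda_gt0 g t bgt S _ _ n t t0 (lexx _))
    => i.
    exists (expR (lambda * t) * K ^+ i) => p s s0 st; rewrite partial// normrM.
    rewrite (ger0_norm (expR_ge0 _)); apply: ler_pM; rewrite ?expR_ge0//.
      by rewrite ler_expR ler_wpM2l// ltW.
    apply: le_trans (le_normr_Rintegral _ (bounded_measurable_integrable_prob P
      (bC i s p))) _ => //.
    apply: (@le_trans _ _ (\int[P]_w (K ^+ i))).
      apply: le_Rintegral => //; first exact: integrable_norm
        (bounded_measurable_integrable_prob P (bC i s p)).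
    by rewrite Rintegral_cst//= probability_setT mulr1.
  move=> s s0 st; under eq_fun do rewrite partial//.
  apply: cvgMr; have [||||//] := @dominated_convergence_Rintegral _ _ R setT P
    measurableT
    (fun p w => (N s w < p)%N%:R * collapse_at g (N s w) w ^+ i)
    (fun w => collapse_at g (N s w) w ^+ i) (fun=> K ^+ i).
  - by move=> p; have [] := bC i s p.
  - move=> w _; apply: cvg_near_cst; exists (N s w).+1 => // p Np.
    by rewrite Np mul1r.
  - exact: cK.
  - by move=> p w _; exact: bnd.
transitivity (expR (- (lambda * t)) * S n t).
  by rewrite /S mulrA -expRD addNr expR0 mul1r.
rewrite HS mulrA -expRD; congr (expR _ * _).
have r : (n.+1%:R : R) != 0 by rewrite pnatr_eq0.
by rewrite -natr1 in r *; field.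
Qed.

End bounded_marks.

End bounded_moments.

(** * Truncation *)

Lemma collapse_ge0 (R : realDomainType) (g : R -> R) (tau z : nat -> R) m :
  (forall k, (1 <= k)%N -> 0 <= z k <= 1) -> (forall s, 0 <= g s) ->
  0 <= collapse g tau z m.
Proof.
move=> z01 g0; apply: le_trans (normr_ge0 (collapse g tau z m)) _.
by apply: collapse_le => // k _; rewrite ger0_norm.
Qed.

Lemma cvg_collapse (R : realType) (g_ : nat -> R -> R) (g : R -> R)
    (tau z : nat -> R) m : (forall s, g_ p s @[p --> \oo] --> g s) ->
  collapse (g_ p) tau z m @[p --> \oo] --> collapse g tau z m.
Proof.
move=> gg; elim: m => [|m ih] /=; first exact: cvg_cst.
by apply: (@cvgD _ R); apply: cvgMr.
Qed.

Lemma cvg_exprn (R : realType) (u : nat -> R) (l : R) n :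
  u p @[p --> \oo] --> l -> u p ^+ n @[p --> \oo] --> l ^+ n.
Proof.
move=> ul; elim: n => [|n ih].
  by under eq_fun do rewrite expr0; exact: cvg_cst.
by under eq_fun do rewrite exprS; rewrite exprS; apply: cvgM.
Qed.

Section truncation.
Context (R : realType).
Implicit Types (x : R) (p : nat).

Definition truncate p x : R := Num.max (- p%:R) (Num.min p%:R x).

Lemma truncate_norm p x : `|truncate p x| <= `|x|.
Proof.
rewrite /truncate; have := ler0n R p; move: (p%:R) => q q0.
by rewrite maxEle minEle; case: (leP q x) => qx; case: ifP => h;
  rewrite ler_norml; have := ler_norm x; have := ler_norm (- x);
    rewrite normrN; lra.
Qed.

Lemma truncate_le p x : `|truncate p x| <= p%:R.
Proof.
rewrite /truncate; have := ler0n R p; move: (p%:R) => q q0.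
by rewrite ler_norml le_max lexx ge_max ge_min lexx /= andbT; lra.
Qed.

Lemma truncate_ge0 p x : 0 <= x -> 0 <= truncate p x.
Proof. by move=> x0; rewrite le_max le_min x0 ler0n orbT. Qed.

Lemma truncate_nd p q x : 0 <= x -> (p <= q)%N -> truncate p x <= truncate q x.
Proof.
move=> x0 pq; have := ler_nat R p q; rewrite pq /truncate => {}pq.
have := ler0n R p; move: (p%:R) (q%:R) pq => a b ab a0.
rewrite !maxEle !minEle; do ![case: ifP => //]; lra.
Qed.

Lemma cvg_truncate x : truncate p x @[p --> \oo] --> x.
Proof.
apply: cvg_near_cst; exists (Num.bound `|x|) => // p /= xp.
have xb : `|x| <= p%:R.
  by apply: le_trans (ltW (archi_boundP (normr_ge0 x))) _; rewrite ler_nat.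
by rewrite /truncate min_r ?max_r//; move: xb; rewrite ler_norml => /andP[].
Qed.

Lemma bounded_measurable_truncate p (g : R -> R) : measurable_fun setT g ->
  bounded_measurable setT (truncate p \o g).
Proof.
move=> mg; split; last by exists p%:R => x _; exact: truncate_le.
by apply: measurable_maxr => //; exact: measurable_minr.
Qed.

End truncation.

Section moments.
Context (R : realType) (d : measure_display) (Om : measurableType d)
  (P : probability Om R) (lambda : R)
  (N : R -> {RV P >-> nat}) (T Z : nat -> {RV P >-> R}).
Hypothesis lambda_gt0 : 0 < lambda.
Hypothesis (N_poisson : poisson_process lambda N T).
Hypothesis (Z_iid : iid_uniform01 Z).
Hypothesis (ZN_indep : independent_sigma P
      (sigma_of_family [set k | (1 <= k)%N] (fun k => Z k : Om -> R))
      (sigma_of_family [set s : R | 0 <= s] (fun s : R => N s : Om -> nat))).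

Local Notation mu := (@lebesgue_measure R).
Local Notation bm := (@bounded_measurable _ Om R setT).

Lemma marks_unit_ae : {ae P, forall w, forall k, (1 <= k)%N -> 0 <= Z k w <= 1}.
Proof.
apply/ae_foralln => -[|k]; first exact: aeW.
have mE : measurable ((Z k.+1 : Om -> R) @^-1` ~` `[0, 1]).
  by rewrite -[X in measurable X]setTI; apply: measurable_funP => //;
    exact: measurableC.
exists ((Z k.+1 : Om -> R) @^-1` ~` `[0, 1]); split => //.
  transitivity (uniform_prob (@ltr01 R) (~` `[0, 1])).
    by apply: Z_iid.2 => //; exact: measurableC.
  rewrite /uniform_prob integral_uniform_pdf setICl.
  by rewrite integral_set0.
move=> w /= h; rewrite in_itv/= => z01; apply: h => _; exact: z01.
Qed.

Lemma measurable_growth_collapse (f : nat -> R -> R) t :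
  (forall k, (1 <= k)%N -> measurable_fun setT (f k)) ->
  measurable_fun setT (growth_collapse N T Z f t).
Proof.
move=> mf; rewrite /growth_collapse.
pose F m (w : Om) := \sum_(1 <= k < m.+1)
    f k (T k w) * (1 - Z k w) * \prod_(k.+1 <= l < m.+1) Z l w.
apply: (@measurable_random_index _ _ _ (N t) F) => // m.
have -> : F m = fun w => \sum_(k <- index_iota 1 m.+1) if (1 <= k < m.+1)%N then
    f k (T k w) * (1 - Z k w) * \prod_(k.+1 <= l < m.+1) Z l w else 0.
  apply/funext => w; rewrite /F big_nat_cond big_mkcond.
  by apply: eq_bigr => k _; rewrite andbT.
apply: measurable_sum => k; case: (boolP (1 <= k < m.+1)%N) => // /andP[k1 _].
apply: measurable_funM; last by apply: measurable_prod => l _.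
apply: measurable_funM; last exact: measurable_funB.
by apply: measurableT_comp => //; exact: mf.
Qed.

(** Almost surely the marks lie in [0, 1], so clamping does not change them, and the jump times are
    positive, so each [f k] may be replaced by [f 1%N] there. *)
Lemma growth_collapse_ae (f : nat -> R -> R) t :
  (forall k s, (1 <= k)%N -> 0 <= s -> f k s = f 1%N s) ->
  {ae P, forall w, growth_collapse N T Z f t w = collapse_at T Z (f 1%N) (N t
    w) w}.
Proof.
move=> f_eq; apply: filterS2 marks_unit_ae (jump_times_gt0_ae N_poisson) => w
  z01 T0.
rewrite /growth_collapse /collapse_at collapseE;
  apply: eq_big_nat => k /andP[k1 _].
have /andP[z0 z1] := z01 k k1.
rewrite clamp01_id// f_eq//; last exact/ltW/T0.
congr (_ * _); apply: eq_big_nat => l /andP[kl _].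
by have /andP[l0 l1] := z01 l (leq_trans (ltn0Sn _) kl); rewrite clamp01_id.
Qed.

Variables (g : R -> R) (n : nat) (t : R).
Hypothesis mg : measurable_fun setT g.
Hypothesis t0 : 0 <= t.
Hypothesis Ig : mu.-integrable `[0, t] (EFin \o (fun s => g s ^+ n)).

(** On a bounded interval 1 + |g|^n is integrable, and it dominates |g|^i for i <= n. *)
Lemma integrable_lower_power i : (i <= n)%N ->
  mu.-integrable `[0, t] (EFin \o (fun s => g s ^+ i)).
Proof.
move=> ni.
have I1 : mu.-integrable `[0, t] (EFin \o (fun s => 1 + `|g s ^+ n|)).
  apply: integrable_realD => //; last exact: integrable_norm Ig.
  by apply: bounded_measurable_integrable_itv; exact: bounded_measurable_cst.
apply: le_integrable I1 => //.
  by apply/measurable_EFinP/measurable_funTS/measurable_funX.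
move=> s _ /=; rewrite lee_fin [leRHS]ger0_norm ?addr_ge0// !normrX.
case: (leP `|g s| 1) => g1.
  by apply: le_trans (exprn_ile1 _ (normr_ge0 _) g1) _; rewrite lerDl exprn_ge0.
by apply: (@le_trans _ _ (`|g s| ^+ n)); rewrite ?lerDr// ler_weXn2l// ltW.
Qed.

Let ga s := `|g s|.

Let mga : measurable_fun setT ga. Proof. exact: measurableT_comp. Qed.

Let Iga i : (i <= n)%N -> mu.-integrable `[0, t] (EFin \o (fun s => ga s ^+ i)).
Proof.
move=> /integrable_lower_power /integrable_norm.
by apply: eq_integrable => // s _ /=; rewrite normrX.
Qed.

Let collapse_count (h : R -> R) w := collapse_at T Z h (N t w) w.

Let truncated_moment p h : measurable_fun setT h ->
  \int[P]_w (collapse_count (truncate p \o h) w ^+ n) =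
  expR (- (n%:R * lambda * t / n.+1%:R)) * chain_sum lambda (truncate p \o h) n
    t.
Proof.
move=> mh; apply: (bounded_collapse_moment lambda_gt0 N_poisson Z_iid ZN_indep)
  => //.
exact: bounded_measurable_truncate.
Qed.

Let bounded_measurable_truncated p h : measurable_fun setT h ->
  bm (fun w => collapse_count (truncate p \o h) w ^+ n).
Proof.
move=> mh; have bh := bounded_measurable_truncate p mh.
apply: bounded_measurableX; split.
  by apply: measurable_collapse_count; case: bh.
by have [K _ hK] := collapse_bound T Z bh; exists K => w _; exact: hK.
Qed.

Let z01 w k : (1 <= k)%N -> 0 <= clamp01 (Z k w) <= 1.
Proof. by move=> _; exact: clamp01_itv. Qed.

(** The truncations of |g| give nondecreasing moments, equal to a constant times chain sums that are
    bounded uniformly in the truncation level; monotone convergence makes the limit finite. *)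
Lemma integrable_collapse_norm :
  P.-integrable setT (EFin \o (fun w => collapse_count ga w ^+ n)).
Proof.
have [[B hB] _] := chain_sum_bound_cvg lambda_gt0
  (fun p => (bounded_measurable_truncate p mga).1)
  (fun s => @cvg_truncate R (ga s)) (fun p s => truncate_norm p (ga s)) Iga
    (leqnn n) t0 (lexx t).
have ga0 s : 0 <= ga s by exact: normr_ge0.
have c0 p w : 0 <= collapse_count (truncate p \o ga) w.
  by apply: collapse_ge0 => [k k1|s]; [exact: z01|exact: truncate_ge0].
pose u p w := (collapse_count (truncate p \o ga) w ^+ n)%:E.
have mu_ p : measurable_fun setT (u p).
  by apply/measurable_EFinP; case: (bounded_measurable_truncated p mga).
have u0 p w : setT w -> (0 <= u p w)%E by move=> _; rewrite lee_fin exprn_ge0.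
have und w : setT w -> nondecreasing_seq (u ^~ w).
  move=> _ p q pq; rewrite lee_fin lerXn2r ?nnegrE//.
  apply: le_trans (ler_norm _) _; apply: collapse_le => [k k1|k _];
    first exact: z01.
  by rewrite ger0_norm ?truncate_ge0//=; exact: truncate_nd.
have ulim w : limn (u ^~ w) = (collapse_count ga w ^+ n)%:E.
  apply: cvg_lim => //; apply/fine_cvgP; split; first exact: nearW.
  by apply: cvg_exprn; apply: cvg_collapse => s; exact: cvg_truncate.
apply/integrableP; split.
  by apply/measurable_EFinP/measurable_funX; exact: measurable_collapse_count.
have -> : (\int[P]_w `|(collapse_count ga w ^+ n)%:E|
  = \int[P]_w limn (u ^~ w))%E.
  apply: eq_integral => w _; rewrite ulim gee0_abs// lee_fin exprn_ge0//.
  by apply: collapse_ge0 => // k k1; exact: z01.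
have cm := @cvg_monotone_convergence _ _ _ P _ measurableT u mu_ u0 und.
rewrite -(cvg_lim _ cm)//; apply: (@le_lt_trans _ _ (expR (- (n%:R * lambda *
  t / n.+1%:R)) * B)%:E); last exact: ltry.
apply: lime_le; first by apply/cvg_ex; eexists; exact: cm.
apply: nearW => p; have Iu := bounded_measurable_integrable_prob P
  (bounded_measurable_truncated p mga).
rewrite -[leLHS]fineK; last exact: integrable_fin_num Iu.
rewrite lee_fin -/(Rintegral P setT _) truncated_moment// ler_wpM2l ?expR_ge0//.
exact: le_trans (ler_norm _) (hB p).
Qed.

(** Let the truncation level tend to infinity in the bounded case: the expectations converge because
    the collapse of |g|, whose [n]-th power is integrable, dominates all truncations, and the chain
    sums converge as well. *)
Lemma collapse_moment_integral :
  (\int[P]_w (collapse_count g w ^+ n)%:E =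
   (expR (- (n%:R * lambda * t / n.+1%:R)) * chain_sum lambda g n t)%:E)%E.
Proof.
have [_ cR] := chain_sum_bound_cvg lambda_gt0
  (fun p => (bounded_measurable_truncate p mg).1)
  (fun s => @cvg_truncate R (g s)) (fun p s => truncate_norm p (g s))
  integrable_lower_power (leqnn n) t0 (lexx t).
have [||||Ic c] := @dominated_convergence_Rintegral _ _ _ setT P measurableT
  (fun p w => collapse_count (truncate p \o g) w ^+ n)
  (fun w => collapse_count g w ^+ n) (fun w => collapse_count ga w ^+ n).
- by move=> p; case: (bounded_measurable_truncated p mg).
- by move=> w _; apply: cvg_exprn; apply: cvg_collapse => s;
    exact: cvg_truncate.
- exact: integrable_collapse_norm.
- move=> p w _; rewrite normrX lerXn2r ?nnegrE//.
    by apply: collapse_ge0 => [k k1|s]; [exact: z01|exact: normr_ge0].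
  by apply: collapse_le => [k k1|k _]; [exact: z01|exact: truncate_norm].
rewrite -[LHS]fineK; last exact: integrable_fin_num Ic.
congr (_%:E); rewrite -/(Rintegral P setT _).
rewrite (funext (fun p => truncated_moment p mg)) in c.
apply: (cvg_unique (@Rhausdorff R) c).
by apply: cvgMr; exact: cR.
Qed.

End moments.

(* [f_eq]: f_k does not depend on k. The identity fails without it: for n = 1
   the right-hand side only involves f_1, while E[Y_t] involves every f_k
   (take f_1 = 0 and f_2 = 1). A function on R_+ is extended by 0 to R. *)
Theorem corollary4p1 (R : realType) (d : measure_display)
    (Om : measurableType d) (P : probability Om R) (lambda : R)
    (N : R -> {RV P >-> nat}) (T Z : nat -> {RV P >-> R})
    (f : nat -> R -> R) (n : nat) (t : R)
    (lambda_gt0 : 0 < lambda)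
    (N_poisson : poisson_process lambda N T)
    (Z_iid : iid_uniform01 Z)
    (ZN_indep : independent_sigma P
      (sigma_of_family [set k | (1 <= k)%N] (fun k => Z k : Om -> R))
      (sigma_of_family [set s : R | 0 <= s] (fun s : R => N s : Om -> nat)))
    (n_ge1 : (1 <= n)%N) (t_ge0 : 0 <= t)
    (f_meas : forall k, (1 <= k)%N -> measurable_fun setT (f k))
    (f_int : forall k, (1 <= k)%N ->
      (@lebesgue_measure R).-integrable `[0, t] (fun s : R => (f k s ^+ n)%:E))
    (f_eq : forall (k : nat) (s : R), (1 <= k)%N -> 0 <= s -> f k s = f 1%N s) :
  'E_P[(fun w => growth_collapse N T Z f t w ^+ n)%R]%E =
  (expR (- (n%:R * lambda * t / n.+1%:R)) *
   \sum_(1 <= k < n.+1) lambda ^+ k *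
     \sum_(p : k.-tuple 'I_n.+1 | chain_to n [seq val i | i <- p])
       simplex_integral k t
         (chain_integrand lambda f k (0%N :: [seq val i | i <- p])))%:E.
Proof.
have mg := f_meas 1%N isT; have Ig := f_int 1%N isT.
rewrite unlock.
transitivity (\int[P]_w (collapse_at T Z (f 1%N) (N t w) w ^+ n)%:E)%E.
  apply: ae_eq_integral => //.
  - by apply/measurable_EFinP/measurable_funX;
      exact: measurable_growth_collapse.
  - apply/measurable_EFinP/measurable_funX.
    exact: measurable_collapse_count.
  - by apply: filterS (growth_collapse_ae N_poisson Z_iid t f_eq) => w /= -> _.
rewrite (collapse_moment_integral lambda_gt0 N_poisson Z_iid ZN_indep mg t_ge0
  Ig).
(* The term k = 0 of [chain_sum] is the indicator of n = 0, which vanishes here, so the sum starts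
   at k = 1. *)
congr ((_ * _)%:E); rewrite /chain_sum big_ltn//= expr0 mul1r.
rewrite (gtn_eqF n_ge1) mulr0n add0r.
apply: eq_big_nat => k _; congr (_ * _); symmetry.
apply: (@sum_simplex_integral R lambda lambda_gt0 f (f 1%N) n t) => //.
exact: integrable_lower_power mg Ig.
Qed.
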